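(* Let $m>1$ be a natural number and $G$ an Abelian group. Then the following statements are equivalent: (1) $\mathrm{E}(G)$ is a strongly $m$-nil clean ring; (2) $G$ is a finite group and, for each $p$-primary component $G_p$ of the group $G$, one has $(p^i-1)\mid (m-1)$ for every integer $i$ with $1\le i\le \mathrm{In}\big(\mathrm{E}(G_p)/J(\mathrm{E}(G_p))\big)$.
   Context: $\mathrm{E}(G)$ denotes the ring of all endomorphisms of the Abelian group $G$, and $J(\cdot)$ the Jacobson radical. An element $x$ of a ring is $m$-potent if $x^m=x$. A ring is strongly $m$-nil clean if each of its elements is a sum of an $m$-potent element and a nilpotent element that commute with each other. For a ring $R$ and $r\in R$, put $\mathrm{In}(r)=\min\{k\ge 1 : r^k=0\}$ if $r$ is nilpotent and $\mathrm{In}(r)=0$ otherwise; the degree of nilpotency of $R$ is $\mathrm{In}(R)=\sup_{r\in R}\mathrm{In}(r)$. The $p$-primary components considered are the nonzero ones, i.e. $p$ ranges over the prime divisors of $|G|$. *)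

(* Defs.v *)
From HB Require Import structures.
From mathcomp Require Import all_boot all_order all_algebra.
From mathcomp Require Import boolp classical_sets cardinality constructive_ereal.
Set Implicit Arguments.
Unset Strict Implicit.
Unset Printing Implicit Defensive.
Import Order.TTheory GRing.Theory Num.Theory.
Local Open Scope ring_scope.
Local Open Scope classical_set_scope.

(* Rings are pzRingType's: the zero ring is allowed, as E(0) is the zero ring. *)

Section Endomorphisms.
Variable G : zmodType.

Definition endo := {additive G -> G}.
HB.instance Definition _ := gen_eqMixin endo.
HB.instance Definition _ := gen_choiceMixin endo.

Lemma endoP (f g : endo) : f =1 g -> f = g.
Proof.
case: f g => [f [[cf]]] [g [[cg]]] /= /funext fg.
by subst g; rewrite (Prop_irrelevance cf cg).
Qed.

Definition endo_zero : endo := GRing.null_fun G : {additive G -> G}.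
Definition endo_one : endo := idfun : {additive G -> G}.
Definition endo_opp (f : endo) : endo := \- f : {additive G -> G}.
Definition endo_add (f g : endo) : endo := f \+ g : {additive G -> G}.
Definition endo_mul (f g : endo) : endo := f \o g : {additive G -> G}.

Fact endo_addA : associative endo_add.
Proof. by move=> f g h; apply: endoP => x /=; rewrite addrA. Qed.
Fact endo_addC : commutative endo_add.
Proof. by move=> f g; apply: endoP => x /=; rewrite addrC. Qed.
Fact endo_add0 : left_id endo_zero endo_add.
Proof. by move=> f; apply: endoP => x /=; rewrite add0r. Qed.
Fact endo_addN : left_inverse endo_zero endo_opp endo_add.
Proof. by move=> f; apply: endoP => x /=; rewrite addNr. Qed.
HB.instance Definition _ :=
  GRing.isZmodule.Build endo endo_addA endo_addC endo_add0 endo_addN.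

Fact endo_mulA : associative endo_mul.
Proof. by move=> f g h; apply: endoP. Qed.
Fact endo_mul1 : left_id endo_one endo_mul.
Proof. by move=> f; apply: endoP. Qed.
Fact endo_mulr1 : right_id endo_one endo_mul.
Proof. by move=> f; apply: endoP. Qed.
Fact endo_mulDl : left_distributive endo_mul +%R.
Proof. by move=> f g h; apply: endoP. Qed.
Fact endo_mulDr : right_distributive endo_mul +%R.
Proof. by move=> f g h; apply: endoP => x; exact: raddfD. Qed.
HB.instance Definition _ := GRing.Zmodule_isPzRing.Build endo
  endo_mulA endo_mul1 endo_mulr1 endo_mulDl endo_mulDr.

End Endomorphisms.

Section Primary.
Variables (p : nat) (G : zmodType).

Definition primary_pred : {pred G} :=
  fun x => `[< exists k : nat, x *+ (p ^ k) = 0 >].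

Fact primary_zmod_closed : zmod_closed primary_pred.
Proof.
split=> [|x y /asboolP[i xi] /asboolP[j yj]].
  by apply/asboolP; exists 0%N.
apply/asboolP; exists (i + j)%N.
by rewrite mulrnBl expnD mulrnA xi mul0rn mulnC mulrnA yj mul0rn subrr.
Qed.
HB.instance Definition _ :=
  GRing.isZmodClosed.Build G primary_pred primary_zmod_closed.

Record primary : Type :=
  Primary { primary_val :> G; _ : primary_val \in primary_pred }.
HB.instance Definition _ := [isSub for primary_val].
HB.instance Definition _ := [Choice of primary by <:].
HB.instance Definition _ := [SubChoice_isSubZmodule of primary by <:].

End Primary.

Section Jacobson.
Variable R : pzRingType.

Definition left_ideal (I : set R) : Prop :=
  [/\ I 0, forall x y, I x -> I y -> I (x + y) & forall a x, I x -> I (a * x)].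

Definition maximal_left_ideal (M : set R) : Prop :=
  [/\ left_ideal M, M <> setT &
      forall I, left_ideal I -> M `<=` I -> I = M \/ I = setT].

Definition jacobson : set R := \bigcap_(M in maximal_left_ideal) M.

Definition jacobson_pred : {pred R} := fun x => `[< jacobson x >].

Fact jacobson_zmod_closed : zmod_closed jacobson_pred.
Proof.
split=> [|x y /asboolP Jx /asboolP Jy]; apply/asboolP; move=> M maxM.
  by case: maxM => [[M0 _ _] _ _].
have [[_ MD MM] _ _] := maxM.
by rewrite -mulN1r; apply: MD; [exact: Jx | by apply: MM; exact: Jy].
Qed.
HB.instance Definition _ :=
  GRing.isZmodClosed.Build R jacobson_pred jacobson_zmod_closed.

Lemma jacobson_Ml a x : x \in jacobson_pred -> a * x \in jacobson_pred.
Proof.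
move=> /asboolP Jx; apply/asboolP; move=> M maxM.
by have [[_ _ MM] _ _] := maxM; apply: MM; exact: Jx.
Qed.

Lemma jacobson_Mr a x : x \in jacobson_pred -> x * a \in jacobson_pred.
Proof.
move=> /asboolP Jx; apply/asboolP; move=> M maxM.
have [[M0 MD MM] MT Mmax] := maxM.
have [Ma|nMa] := pselect (M a); first exact: MM.
(* the colon ideal (M : a) is again maximal *)
suff maxN : maximal_left_ideal [set b | M (b * a)] by exact: (Jx _ maxN).
split=> [|NT|I [I0 ID IM] NI].
- split=> [|b c|b c] /=; first by rewrite mul0r.
    by rewrite mulrDl; exact: MD.
  by rewrite -mulrA; exact: MM.
- have : [set b | M (b * a)] 1 by rewrite NT.
  by rewrite /= mul1r.
have [IN|] := pselect (I `<=` [set b | M (b * a)]).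
  by left; apply/seteqP.
move=> /existsNP[b /not_implyP[Ib /= nMba]]; right.
pose K : set R := [set y | exists z c, [/\ M z, I c & y = z + c * a]].
have KT : K = setT.
  case: (Mmax K) => //.
  - split.
    + by exists 0, 0; rewrite mul0r addr0.
    + move=> _ _ [z [c [Mz Ic ->]]] [z' [c' [Mz' Ic' ->]]].
      exists (z + z'), (c + c'); split; [exact: MD | exact: ID |].
      by rewrite mulrDl addrACA.
    + move=> d _ [z [c [Mz Ic ->]]]; exists (d * z), (d * c).
      by split; [exact: MM | exact: IM | rewrite mulrDr mulrA].
  - by move=> z Mz; exists z, 0; rewrite mul0r addr0.
  - move=> KM; case: nMba; rewrite -KM.
    by exists 0, b; rewrite add0r.
have Iall d : I d.
  have [z [c [Mz Ic dE]]] : K (d * a) by rewrite KT.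
  have -> : d = (d - c) + c by rewrite subrK.
  by apply: ID => //; apply: NI; rewrite /= mulrBl dE addrK.
by apply/seteqP; split.
Qed.

(* The library's additive quotient [Quotient.quot] carries a ring structure only
   for commutative rings, hence the multiplication below. *)
Definition jquot : Type := Quotient.quot jacobson_pred.
HB.instance Definition _ := GRing.Zmodule.on jquot.

Definition jquot_class (x : R) : jquot := \pi_(Quotient.quot jacobson_pred)%qT x.
Definition jquot_repr (x : jquot) : R :=
  generic_quotient.repr (x : Quotient.quot jacobson_pred).

Lemma jquot_reprK x : jquot_class (jquot_repr x) = x.
Proof. exact: generic_quotient.reprK. Qed.

Lemma jquot_classP x y :
  (jquot_class x = jquot_class y) <-> (x - y \in jacobson_pred).
Proof. by rewrite Quotient.idealrBE; split=> [?|/eqP//]; apply/eqP. Qed.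

Lemma jquot_class0 : jquot_class 0 = 0.
Proof. exact: (@pi_zeror _ _ _ _ _ (Quotient.quot jacobson_pred)). Qed.

Lemma jquot_classN x : jquot_class (- x) = - jquot_class x.
Proof. exact: (@pi_oppr _ _ _ _ _ (Quotient.quot jacobson_pred)). Qed.

Lemma jquot_classD x y : jquot_class (x + y) = jquot_class x + jquot_class y.
Proof. exact: (@pi_addr _ _ _ _ _ (Quotient.quot jacobson_pred)). Qed.

Definition jquot_one : jquot := jquot_class 1.
Definition jquot_mul (x y : jquot) : jquot :=
  jquot_class (jquot_repr x * jquot_repr y).

Lemma jquot_class_mul x y :
  jquot_mul (jquot_class x) (jquot_class y) = jquot_class (x * y).
Proof.
apply/jquot_classP; set x' := jquot_repr _; set y' := jquot_repr _.
have xx' : x' - x \in jacobson_pred by apply/jquot_classP; rewrite jquot_reprK.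
have yy' : y' - y \in jacobson_pred by apply/jquot_classP; rewrite jquot_reprK.
have -> : x' * y' - x * y = x' * (y' - y) + (x' - x) * y.
  by rewrite mulrBr mulrBl addrA subrK.
by apply: rpredD; [exact: jacobson_Ml | exact: jacobson_Mr].
Qed.

Fact jquot_mulA : associative jquot_mul.
Proof.
move=> x y z; rewrite -[x]jquot_reprK -[y]jquot_reprK -[z]jquot_reprK.
by rewrite !jquot_class_mul mulrA.
Qed.
Fact jquot_mul1 : left_id jquot_one jquot_mul.
Proof. by move=> x; rewrite -[x]jquot_reprK jquot_class_mul mul1r. Qed.
Fact jquot_mulr1 : right_id jquot_one jquot_mul.
Proof. by move=> x; rewrite -[x]jquot_reprK jquot_class_mul mulr1. Qed.
Fact jquot_mulDl : left_distributive jquot_mul +%R.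
Proof.
move=> x y z; rewrite -[x]jquot_reprK -[y]jquot_reprK -[z]jquot_reprK.
by rewrite -jquot_classD !jquot_class_mul mulrDl jquot_classD.
Qed.
Fact jquot_mulDr : right_distributive jquot_mul +%R.
Proof.
move=> x y z; rewrite -[x]jquot_reprK -[y]jquot_reprK -[z]jquot_reprK.
by rewrite -jquot_classD !jquot_class_mul mulrDr jquot_classD.
Qed.
HB.instance Definition _ := GRing.Zmodule_isPzRing.Build jquot
  jquot_mulA jquot_mul1 jquot_mulr1 jquot_mulDl jquot_mulDr.

Lemma jquot_class1 : jquot_class 1 = 1.
Proof. by []. Qed.

Lemma jquot_classM x y : jquot_class (x * y) = jquot_class x * jquot_class y.
Proof. by rewrite -jquot_class_mul. Qed.

End Jacobson.

Section NilClean.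
Variable R : pzRingType.

Definition potent (m : nat) (x : R) : Prop := x ^+ m = x.

Definition nilpotent_elt (r : R) : Prop :=
  exists k : nat, (0 < k)%N && (r ^+ k == 0).

Definition strongly_nil_clean (m : nat) : Prop :=
  forall a : R, exists e q : R,
    [/\ potent m e, nilpotent_elt q, a = e + q & e * q = q * e].

Definition nil_index (r : R) : nat :=
  if pselect (nilpotent_elt r) is left nil_r then ex_minn nil_r else 0%N.

(* The supremum is taken in the extended integers \bar int, where every
   nonempty set of naturals has one (+oo if the set is unbounded). *)
Definition nil_degree : \bar int :=
  supremum -oo%E (range (fun r : R => ((nil_index r)%:Z)%:E)).

Lemma nil_degree_supremum :
  supremums (range (fun r : R => ((nil_index r)%:Z)%:E)) nil_degree.
Proof.
rewrite /nil_degree; set A := (X in supremums X).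
have A0 : A !=set0 by exists ((nil_index 0)%:Z%:E); exists 0.
suff [s sA] : supremums A !=set0.
  by rewrite /supremum ifF; [exact: xgetI sA | apply/eqP/nonemptyPn].
have [[N ubN]|unb] := pselect (exists N, forall r : R, (nil_index r <= N)%N).
- have exP : exists n, `[< exists r : R, nil_index r = n >].
    by exists (nil_index 0); apply/asboolP; exists 0.
  have ubP n : `[< exists r : R, nil_index r = n >] -> (n <= N)%N.
    by move=> /asboolP[r <-].
  case: (ex_maxnP exP ubP) => n /asboolP[r rn] nmax.
  exists (n%:Z%:E); split=> [_ [r' _ <-]|y yub]; last first.
    by apply: yub; exists r => //; rewrite rn.
  by rewrite lee_fin lez_nat; apply: nmax; apply/asboolP; exists r'.
- exists +oo%E; split=> [x _|y yub]; first exact: leey.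
  case: y yub => [z yub||yub] //; exfalso; last first.
    by have := yub _ (ex_intro2 _ _ 0 I erefl).
  apply: unb; exists `|z|%N => r.
  have := yub _ (ex_intro2 _ _ r I erefl).
  by rewrite lee_fin => /le_trans/(_ (lez_abs z)); rewrite lez_nat.
Qed.

End NilClean.

(* Main.v *)
(** Let u_k be the dimension over F_p of the Ulm factor p^k G[p] / p^(k+1) G[p].
    If a = e + q with e potent and q a commuting nilpotent, then a^m - a is
    nilpotent; for a = 2 this bounds the exponent of G.  A family in p^k G[p]
    that is free modulo p^(k+1) G is, up to that subgroup, the socle of a direct
    summand, so every matrix over F_p is realized on it by an endomorphism of G.
    Realizing the multiplication by a generator of the multiplicative group of
    the field with p^i elements, (1) forces p^i - 1 | m - 1 for 1 <= i <= u_k.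
    Conversely, when G has bounded exponent these divisibilities bound the u_k,
    hence G is finite, and they make a^m - a nilpotent for every endomorphism a:
    on an Ulm factor, a acts as a matrix whose characteristic polynomial divides
    a power of X^m - X.  In a ring of positive characteristic this gives back
    (1), the potent part of a being a high power a^(p^n) on each primary
    component.  Finally J(E(G_p)) consists of the endomorphisms acting as zero on
    all Ulm factors, so the degree of nilpotency of E(G_p)/J(E(G_p)) is the
    maximum of the u_k: shifts along free families attain it, and if r is
    nilpotent modulo J with r^(d-1) not in J, then x, r x, ..., r^(d-1) x is free
    in some Ulm factor. *)

From HB Require Import structures.
Require Import Defs.
From mathcomp Require Import all_boot all_order all_algebra.
From mathcomp Require Import all_fingroup all_field cyclic.
From mathcomp Require Import ring zify.
From mathcomp Require Import boolp classical_sets cardinality constructive_ereal.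
Set Implicit Arguments.
Unset Strict Implicit.
Unset Printing Implicit Defensive.
Import Order.TTheory GRing.Theory.
Local Open Scope ring_scope.

(** * Strong nil-cleanness from the nilpotency of a^m - a *)

Section CommutingNilpotents.
Variable R : pzRingType.
Implicit Types x y : R.

Lemma nilpotent_eltP x : nilpotent_elt x <-> exists k, x ^+ k = 0.
Proof.
split=> [[k /andP[_ /eqP xk]]|[k xk]]; first by exists k.
by exists k.+1; rewrite exprS xk mulr0 eqxx.
Qed.

Lemma nilpotentM_comm x y : GRing.comm x y -> nilpotent_elt x ->
  nilpotent_elt (x * y).
Proof.
move=> xy /nilpotent_eltP[k xk]; apply/nilpotent_eltP; exists k.
by rewrite exprMn_comm // xk mul0r.
Qed.

Lemma nilpotentD_comm x y : GRing.comm x y -> nilpotent_elt x ->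
  nilpotent_elt y -> nilpotent_elt (x + y).
Proof.
move=> xy /nilpotent_eltP[i xi] /nilpotent_eltP[j yj].
apply/nilpotent_eltP; exists (i + j)%N.
rewrite exprDn_comm // big1 // => -[l /= _] _.
have [jl|/ltnW lj] := leqP j l.
  by rewrite -(subnK jl) exprD yj !mulr0 mul0rn.
have -> : (i + j - l = (j - l) + i)%N by rewrite addnC addnBAC.
by rewrite exprD xi mulr0 mul0r mul0rn.
Qed.

Lemma nilpotentN x : nilpotent_elt x -> nilpotent_elt (- x).
Proof.
move=> /nilpotent_eltP[k xk]; apply/nilpotent_eltP; exists k.
by rewrite exprNn xk mulr0.
Qed.

Lemma nilpotentX x n : nilpotent_elt (x ^+ n) -> nilpotent_elt x.
Proof.
move=> /nilpotent_eltP[k xk]; apply/nilpotent_eltP.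
by exists (n * k)%N; rewrite exprM.
Qed.

(** Since [e ^+ m = e], the difference is [(a ^+ m - e ^+ m) - q], whose first term is a multiple of
    [a - e = q]; all factors commute. *)
Lemma strongly_nil_clean_nilpotent m (a : R) : strongly_nil_clean R m ->
  nilpotent_elt (a ^+ m - a).
Proof.
move=> /(_ a)[e [q [em qnil -> eq_qe]]].
have cq : GRing.comm q (e + q) by rewrite /GRing.comm mulrDr mulrDl eq_qe.
have -> : (e + q) ^+ m - (e + q) = ((e + q) ^+ m - e ^+ m) - q.
  by rewrite em opprD addrA.
have cqe : GRing.comm q e by rewrite /GRing.comm eq_qe.
rewrite subrXX_comm; last by apply: commr_sym; apply: commrD.
rewrite [e + q]addrC addrK.
set s := \sum_(_ < _) _.
have cqs : GRing.comm q s.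
  apply: commr_sum => i _; apply: commrM; apply: commrX => //.
  by rewrite addrC.
apply: nilpotentD_comm (nilpotentM_comm cqs qnil) (nilpotentN qnil).
by apply: commrN; apply: commr_sym; apply: commrM.
Qed.

End CommutingNilpotents.

Section CommutativeNilClean.
Variable C : comPzRingType.
Implicit Types a v w x y r e : C.

Let nilM x y : nilpotent_elt x -> nilpotent_elt (x * y).
Proof. by apply: nilpotentM_comm; exact: mulrC. Qed.
Let nilD x y : nilpotent_elt x -> nilpotent_elt y -> nilpotent_elt (x + y).
Proof. by apply: nilpotentD_comm; exact: mulrC. Qed.

Lemma exprD_prime p x y : prime p ->
  exists r, (x + y) ^+ p = x ^+ p + y ^+ p + (x * y * r) *+ p.
Proof.
case: p => [|[|p]] // pr_p.
rewrite exprDn big_ord_recl big_ord_recr /= subn0 mulr1 bin0 mulr1n.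
rewrite /bump /= add1n subnn expr0 mul1r binn mulr1n.
exists (\sum_(i < p.+1)
  (x ^+ (p - i) * y ^+ i) *+ ('C(p.+2, i.+1) %/ p.+2)).
rewrite -addrA; congr (_ + _); rewrite addrC; congr (_ + _).
rewrite mulr_sumr -sumrMnl; apply: eq_bigr => i _ /=.
rewrite mulrnAr -mulrnA divnK; last first.
  by rewrite prime_dvd_bin //= ltnS ltn_ord.
rewrite add1n mulrACA -!exprS subSS subSn //.
by rewrite -ltnS.
Qed.

(** The factor [x] is kept in the error term so that torsion of [x] alone can kill it. *)
Lemma exprD_prime_pow p n x y : prime p ->
  exists r, (x + y) ^+ (p ^ n) = x ^+ (p ^ n) + y ^+ (p ^ n) + (x * r) *+ p.
Proof.
move=> pr_p; elim: n => [|n [r IH]].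
  by exists 0; rewrite !expr1 mulr0 mul0rn addr0.
rewrite !expnSr !exprM IH.
have [s ->] := exprD_prime (x ^+ (p ^ n) + y ^+ (p ^ n)) ((x * r) *+ p) pr_p.
have [t ->] := exprD_prime (x ^+ (p ^ n)) (y ^+ (p ^ n)) pr_p.
have [x' ->] : exists x', x ^+ (p ^ n) = x * x'.
  by exists (x ^+ (p ^ n).-1); rewrite -exprS prednK // expn_gt0 prime_gt0.
have [y' ->] : exists y', ((x * r) *+ p) ^+ p = (x * y') *+ p.
  exists (r * ((x * r) *+ p) ^+ p.-1).
  by rewrite mulrA -(mulrnAl (x * r)) -exprS prednK // prime_gt0.
set z := y ^+ _.
exists (x' * z * t + y' + (x * x' + z) * (r *+ p) * s).
rewrite !mulrDr !mulrnDl !addrA; ring.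
Qed.

(** Each [p]-th power adds a factor [p] to the error, until the torsion of [x] kills it. *)
Lemma expr_eq_mod_prime p k n u v x r : prime p -> u = v + (x * r) *+ p ->
  x *+ p ^ k = 0 -> (k <= n.+1)%N -> u ^+ (p ^ n) = v ^+ (p ^ n).
Proof.
move=> pr_p uE xk kn.
suff {kn} [s ->] : exists s, u ^+ (p ^ n) = v ^+ (p ^ n) + (x * s) *+ p ^ n.+1.
  by rewrite -mulrnAl -(subnK kn) expnD mulnC mulrnA xk mul0rn mul0r addr0.
elim: n => [|n [s IH]]; first by exists r; rewrite !expr1 expn1.
rewrite expnSr !exprM IH.
have [t ->] := exprD_prime (v ^+ (p ^ n)) ((x * s) *+ p ^ n.+1) pr_p.
have /prednK Dp := prime_gt0 pr_p.
(* The [p]-th power of the old error carries [p ^ (n.+1 * p)], from which [p ^ n.+2] is split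
   off. *)
exists ((s * (x * s) ^+ p.-1) *+ p ^ (n.+1 * p - n.+2) + v ^+ (p ^ n) * s * t).
rewrite -addrA; congr (_ + _); rewrite mulrDr mulrnDl; congr (_ + _).
  rewrite mulrnAr -mulrnA -expnD subnK; last first.
    by apply: leq_trans (leq_mul (leqnn n.+1) (prime_gt1 pr_p)); lia.
  by rewrite exprMn_n -expnM mulrA -exprS Dp.
by rewrite [(p ^ n.+2)%N]expnSr mulrnA !(mulrnAr, mulrnAl) mulrCA !mulrA.
Qed.

(** The [p ^ t]-th power removes [w] up to a multiple of [v *+ p]; [k] further [p]-th powers remove
    that error. *)
Lemma exprD_nilpotent_prime_pow p k v w : prime p -> v *+ p ^ k = 0 ->
  nilpotent_elt w -> exists N, forall n, (N <= n)%N ->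
  (v + w) ^+ (p ^ n) = v ^+ (p ^ n).
Proof.
move=> pr_p vk /nilpotent_eltP[t wt].
have [r rE] := exprD_prime_pow t v w pr_p.
have wpt0 : w ^+ (p ^ t) = 0.
  by rewrite -(subnK (ltnW (ltn_expl t (prime_gt1 pr_p)))) exprD wt mulr0.
rewrite wpt0 addr0 in rE.
exists (t + k)%N => n tkn.
rewrite -(subnK (leq_trans (leq_addr k t) tkn)) addnC expnD !exprM.
by apply: (expr_eq_mod_prime pr_p rE vk); lia.
Qed.

Lemma nilpotent_exprS_sub a m n : nilpotent_elt (a ^+ m.+1 - a) ->
  nilpotent_elt (a ^+ (m * n).+1 - a).
Proof.
have E i : a ^+ i.+1 - a = a * (a ^+ i - 1) by rewrite mulrBr mulr1 -exprS.
by rewrite !E exprM -[in X in _ -> X](expr1n _ n) subrXX mulrA; exact: nilM.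
Qed.

(** Take [e = a ^+ (p ^ n)]: a large [n] gives [e ^+ m = e], and [p ^ n = 1] modulo the part [m'] of
    [m - 1] prime to [p] makes [a - e] nilpotent. The form [e = a * b] serves to glue different
    primes orthogonally. *)
Lemma strongly_nil_clean_primary_elt p k m a : prime p -> (1 < m)%N ->
  a *+ p ^ k = 0 -> nilpotent_elt (a ^+ m - a) ->
  exists e b, [/\ e ^+ m = e, nilpotent_elt (a - e) & e = a * b].
Proof.
move=> pr_p m_gt1 ak nil_am.
have Dm : m = m.-1.+1 by rewrite prednK // ltnW.
have [s [m' pm' Dm']] :
    exists s, exists2 m', coprime p m' & m.-1 = (m' * p ^ s)%N.
  have /(pfactor_coprime pr_p)[m' pm' Dm'] : (0 < m.-1)%N by rewrite -ltnS -Dm.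
  by exists (logn p m.-1), m'.
have pr_gt0 n : (0 < p ^ n)%N by rewrite expn_gt0 prime_gt0.
have nil_pa r : nilpotent_elt ((a * r) *+ p).
  apply/nilpotent_eltP; exists k.+1.
  by rewrite exprMn_n exprMn exprS -!mulrnAl expnSr mulrnA ak !(mul0rn, mul0r).
have nil_am' : nilpotent_elt (a ^+ m'.+1 - a).
  apply: (@nilpotentX _ _ (p ^ s)).
  have [r] := exprD_prime_pow s a (a ^+ m'.+1 - a) pr_p.
  rewrite addrC subrK; set d := (_ - a) ^+ _ => E.
  (* Up to multiples of [a *+ p], the [p ^ s]-th power is additive; moreover
     [(m' + 1) p ^ s = (p ^ s - 1) + m]. *)
  have -> : d = a ^+ (p ^ s).-1 * (a ^+ m - a) - (a * r) *+ p.
    rewrite mulrBr -exprD -exprSr prednK //.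
    have -> : ((p ^ s).-1 + m = m'.+1 * p ^ s)%N.
      by rewrite Dm Dm' addnS -addSn prednK // mulSn.
    by rewrite exprM E; ring.
  by apply: nilD (nilpotentN (nil_pa r)); rewrite mulrC; exact: nilM.
have [N expN] := exprD_nilpotent_prime_pow pr_p ak nil_am.
have [n [Nn [q Dq]]] :
    exists n, (N <= n)%N /\ exists q, (p ^ n = (m' * q).+1)%N.
  (* By Euler's theorem, [p ^ n = 1] modulo [m'] for this [n]. *)
  exists (totient m' * N)%N; split.
    by rewrite leq_pmull // totient_gt0; case: (m') pm' Dm' => // _; lia.
  exists ((p ^ (totient m' * N)).-1 %/ m')%N.
  rewrite [(m' * _)%N]mulnC divnK ?prednK //.
  rewrite -subn1 -eqn_mod_dvd // expnM -modnXm.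
  by rewrite Euler_exp_totient // modnXm exp1n.
exists (a ^+ (p ^ n)), (a ^+ (p ^ n).-1); split.
- by rewrite -exprM mulnC exprM -[RHS]expN // [a + _]addrC subrK.
- by rewrite -opprB Dq; apply/nilpotentN/nilpotent_exprS_sub.
- by rewrite -exprS prednK.
Qed.

Lemma exprD_orthogonal m x y : (0 < m)%N -> x * y = 0 ->
  (x + y) ^+ m = x ^+ m + y ^+ m.
Proof.
case: m => // m _ xy; elim: m => // m IH.
have xyE : x * y ^+ m.+1 = 0 by rewrite exprS mulrA xy mul0r.
have yxE : y * x ^+ m.+1 = 0 by rewrite exprS mulrA [y * x]mulrC xy mul0r.
by rewrite exprS IH mulrDl !mulrDr -!exprS xyE yxE addr0 add0r.
Qed.

(* Bezout coefficients of coprime p^k and n split an element of order dividing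
   p^k n into two orthogonal ones. *)
Lemma strongly_nil_clean_torsion_elt n m a : (0 < n)%N -> (1 < m)%N ->
  a *+ n = 0 -> nilpotent_elt (a ^+ m - a) ->
  exists e b, [/\ e ^+ m = e, nilpotent_elt (a - e) & e = a * b].
Proof.
move=> + m_gt1; elim/ltn_ind: n a => n IH a n_gt0 an nil_am.
have [n1|n_gt1] := leqP n 1.
  have a0 : a = 0 by rewrite -[a]mulr1n -an; congr (_ *+ _); lia.
  exists 0, 0; rewrite a0 expr0n mulr0 subrr; split => //.
    by case: (m) m_gt1.
  by apply/nilpotent_eltP; exists 1%N.
have pr_p := pdiv_prime n_gt1; set p := pdiv n in pr_p.
have [n' pn' Dn] := pfactor_coprime pr_p n_gt0.
set k := logn p n in Dn.
have k_gt0 : (0 < k)%N by rewrite logn_gt0 mem_primes pr_p n_gt0 pdiv_dvd.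
have n'_gt0 : (0 < n')%N by case: (n') Dn n_gt0 => // ->.
have n'n : (n' < n)%N.
  by rewrite Dn -{1}[n']muln1 ltn_pmul2l // -(exp1n k) ltn_exp2r // prime_gt1.
have cop : coprime (p ^ k) n' by rewrite coprimeXl.
(* Idempotents modulo [n]: [a *+ c] is killed by [p ^ k] and [a *+ d] by [n']. *)
pose c := chinese (p ^ k) n' 1 0; pose d := chinese (p ^ k) n' 0 1.
have eq_modn i j : (i = j %[mod p ^ k])%N -> (i = j %[mod n'])%N ->
    forall b, (a * b) *+ i = (a * b) *+ j.
  move=> ij ij' b.
  have /eqP : (i = j %[mod n])%N.
    by apply/eqP; rewrite Dn mulnC chinese_remainder // ij ij' !eqxx.
  have abn : (a * b) *+ n = 0 by rewrite -mulrnAl an mul0r.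
  move=> /eqP ijn; rewrite (divn_eq i n) (divn_eq j n) ijn !mulrnDr.
  by rewrite ![(_ * n)%N]mulnC !mulrnA abn !mul0rn.
have [cp cn' dp dn'] : [/\ c = 1 %[mod p ^ k], c = 0 %[mod n'],
    d = 0 %[mod p ^ k] & d = 1 %[mod n']].
  by split; rewrite ?(chinese_modl cop) ?(chinese_modr cop).
have ac b : (a * b) *+ (c ^ m) = (a * b) *+ c.
  apply: eq_modn; rewrite -modnXm ?cp ?cn' modnXm ?exp1n //.
  by rewrite exp0n // ltnW.
have ad b : (a * b) *+ (d ^ m) = (a * b) *+ d.
  apply: eq_modn; rewrite -modnXm ?dp ?dn' modnXm ?exp1n //.
  by rewrite exp0n // ltnW.
have am1 : a ^+ m = a * a ^+ m.-1 by rewrite -exprS prednK // ltnW.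
have acp : a *+ c *+ p ^ k = 0.
  rewrite -mulrnA -[a]mulr1 -[RHS](mulr0n (a * 1)); apply: eq_modn.
    by rewrite modnMl mod0n.
  by rewrite -modnMml cn' !(mod0n, mul0n).
have adn' : a *+ d *+ n' = 0.
  rewrite -mulrnA -[a]mulr1 -[RHS](mulr0n (a * 1)); apply: eq_modn.
    by rewrite -modnMml dp !(mod0n, mul0n).
  by rewrite modnMl mod0n.
have nil_c : nilpotent_elt ((a *+ c) ^+ m - a *+ c).
  rewrite exprMn_n am1 ac -am1 -mulrnBl -mulr_natr.
  exact: nilM.
have nil_d : nilpotent_elt ((a *+ d) ^+ m - a *+ d).
  rewrite exprMn_n am1 ad -am1 -mulrnBl -mulr_natr.
  exact: nilM.
have [e1 [b1 [e1m nil1 De1]]] :=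
  strongly_nil_clean_primary_elt pr_p m_gt1 acp nil_c.
have [e2 [b2 [e2m nil2 De2]]] := IH n' n'n _ n'_gt0 adn' nil_d.
exists (e1 + e2), (b1 *+ c + b2 *+ d); split.
(* [e1 * e2] is a multiple of [(a *+ c) * (a *+ d)], which is zero as [n] divides [c * d]. *)
- rewrite exprD_orthogonal ?e1m ?e2m // ?(ltnW m_gt1) // De1 De2.
  rewrite mulrACA; suff -> : (a *+ c) * (a *+ d) = 0 by rewrite mul0r.
  rewrite mulrnAl mulrnAr -mulrnA -[RHS](mulr0n (a * a)); apply: eq_modn.
    by rewrite -modnMml dp !(mod0n, mul0n).
  by rewrite -modnMmr cn' !(mod0n, muln0).
- have -> : a - (e1 + e2) = (a *+ c - e1) + (a *+ d - e2).
    suff {1}-> : a = a *+ c + a *+ d by rewrite opprD addrACA.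
    rewrite -mulrnDr -[a in RHS]mulr1 (@eq_modn _ 1%N) ?mulr1 //.
      by rewrite -modnDmr dp mod0n addn0 cp.
    by rewrite -modnDml cn' mod0n add0n dn'.
  exact: nilD.
- by rewrite De1 De2 mulrDr !mulrnAr !mulrnAl.
Qed.

End CommutativeNilClean.

(** * Reduction to a commutative subring: the bicommutant of an element *)

Section Bicommutant.
Variables (R : pzRingType) (a : R).

Definition bicomm_pred : {pred R} :=
  fun x => `[< forall y, GRing.comm a y -> GRing.comm x y >].

Fact bicomm_subring_closed : subring_closed bicomm_pred.
Proof.
split=> [|x y /asboolP cx /asboolP cy|x y /asboolP cx /asboolP cy];
  apply/asboolP => z az; apply: commr_sym.
- exact: commr1.
- by apply: commrB; apply: commr_sym; [exact: cx | exact: cy].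
- by apply: commrM; apply: commr_sym; [exact: cx | exact: cy].
Qed.

Record bicomm : Type :=
  Bicomm { bicomm_val :> R; _ : bicomm_val \in bicomm_pred }.
HB.instance Definition _ := [isSub for bicomm_val].
HB.instance Definition _ := [Choice of bicomm by <:].
HB.instance Definition _ :=
  GRing.SubChoice_isSubPzRing.Build R bicomm_pred bicomm bicomm_subring_closed.

(** Every member commutes with [a], so it lies in the centralizer of [a], with which all members
    commute. *)
Fact bicomm_mulC : commutative (@GRing.mul bicomm).
Proof.
move=> [x cx] [y cy]; apply: val_inj => /=.
have /asboolP cxy := cx; have /asboolP cyx := cy.
by apply: cxy; apply: commr_sym; apply: cyx; exact: commr_refl.
Qed.
HB.instance Definition _ :=
  GRing.PzRing_hasCommutativeMul.Build bicomm bicomm_mulC.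


Fact bicomm_self : a \in bicomm_pred.
Proof. by apply/asboolP. Qed.

End Bicommutant.

Lemma strongly_nil_cleanP (R : pzRingType) n m : (0 < n)%N -> (1 < m)%N ->
  n%:R = 0 :> R -> (forall a : R, nilpotent_elt (a ^+ m - a)) ->
  strongly_nil_clean R m.
Proof.
move=> n_gt0 m_gt1 n0 nil_am a.
pose c : bicomm a := Bicomm (bicomm_self a).
have cn : c *+ n = 0.
  by apply: val_inj; rewrite raddfMn raddf0 /= -mulr_natr n0 mulr0.
have nilc (x : bicomm a) : nilpotent_elt (val x) <-> nilpotent_elt x.
  split=> /nilpotent_eltP[k xk]; apply/nilpotent_eltP; exists k.
    by apply: val_inj; rewrite rmorphXn rmorph0.
  by rewrite -rmorphXn xk rmorph0.
have nil_cm : nilpotent_elt (c ^+ m - c).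
  by apply/nilc; rewrite rmorphB rmorphXn; exact: nil_am.
have [e [b [em nil_ce _]]] :=
  strongly_nil_clean_torsion_elt n_gt0 m_gt1 cn nil_cm.
exists (val e), (a - val e); split.
- by rewrite /potent -rmorphXn em.
- by have /nilc := nil_ce; rewrite rmorphB.
- by rewrite addrC subrK.
- rewrite mulrBr mulrBl; congr (_ - _).
  by have := mulrC e c => /(congr1 val).
Qed.

(** * Matrices over prime fields *)

Lemma expr_fixed_dvd (R : pzSemiRingType) (z : R) q m : (0 < q)%N ->
  (1 < m)%N -> z ^+ q = z -> (q - 1 %| m - 1)%N -> z ^+ m = z.
Proof.
move=> q_gt0 m_gt1 zq /dvdnP[c Dc].
have -> : m = (c * (q - 1)).+1 by lia.
elim: c {Dc} => [|c IH]; first by rewrite expr1.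
have -> : ((c.+1 * (q - 1)).+1 = c * (q - 1) + q)%N by lia.
by rewrite exprD zq -exprSr IH.
Qed.

Import VectorInternalTheory.

Section PrimeFieldMatrices.
Variables (p : nat) (pr_p : prime p).

(** Induction on the degree. An irreducible [g] of degree [i] has a root in the field with [p ^ i]
    elements, all of which are roots of [X^m - X] when [p ^ i - 1] divides [m - 1]. *)
Lemma dvdp_pow_potent m (g : {poly 'F_p}) : (1 < m)%N -> g != 0 ->
  (forall i, (1 <= i < size g)%N -> (p ^ i - 1 %| m - 1)%N) ->
  exists t, g %| ('X^m - 'X) ^+ t.
Proof.
move=> m_gt1; move: {2}(size g) (leqnn (size g)) => n.
elim: n g => [|n IH] g szg g0 Dm.
  by rewrite leqn0 size_poly_eq0 (negPf g0) in szg.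
have [sz1|sz_gt1] := leqP (size g) 1.
  by exists 0%N; rewrite expr0 dvdp1 eqn_leq sz1 lt0n size_poly_eq0.
have [irr_g|] := pselect (irreducible_poly g).
  exists 1%N; have [L dimL [z rz _]] := irredp_FAdjoin irr_g.
  have zE : z ^+ m = z.
    apply: (@expr_fixed_dvd _ _ (p ^ (size g).-1)) => //.
    - by rewrite expn_gt0 prime_gt0.
    - have := memvf z.
      by rewrite (@Fermat's_little_theorem _ _ {:L}%AS) dimL card_Fp // => /eqP.
    - by apply: Dm; lia.
  (* If [g] did not divide [X^m - X], the two would be coprime, against their common root [z]. *)
  rewrite expr1; apply: contraT => ndvd.
  have := irreducible_poly_coprime ('X^m - 'X) irr_g; rewrite ndvd.
  rewrite -(coprimep_map (in_alg L)) => /coprimep_root/(_ rz).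
  by rewrite rmorphB /= map_polyXn map_polyX !hornerE zE subrr eqxx.
(* A reducible [g] is a product of two smaller factors, whose exponents add. *)
move=> /not_andP; rewrite sz_gt1 => -[//|/existsNP[q]].
move=> /not_implyP[szq /not_implyP[qg /negP nqg]].
have {}szq : size q != 1%N := szq.
have [h Dg] := dvdpP _ _ qg.
have [h0 q0] : h != 0 /\ q != 0.
  by move: g0; rewrite Dg mulf_eq0 negb_or => /andP[].
have szE : size g = (size h + size q).-1 by rewrite Dg size_mul.
have szh : size h != 1%N.
  apply/eqP => /eqP/size_poly1P[c c0 Dh]; case: nqg.
  by rewrite Dg Dh mul_polyC eqp_sym eqp_scale.
have := h0; have := q0; rewrite -!size_poly_eq0 => szq0 szh0.
have [lt_hg lt_qg] : (size h < size g)%N /\ (size q < size g)%N.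
  by rewrite szE; move: (size h) (size q) szh szq szh0 szq0 => a b; lia.
have [||s hs] := IH h _ h0; first by rewrite -ltnS (leq_trans lt_hg).
  by move=> i /andP[i_gt0 ih]; apply: Dm; rewrite i_gt0 (ltn_trans ih).
have [||t qt] := IH q _ q0; first by rewrite -ltnS (leq_trans lt_qg).
  by move=> i /andP[i_gt0 iq]; apply: Dm; rewrite i_gt0 (ltn_trans iq).
by exists (s + t)%N; rewrite Dg exprD dvdp_mul.
Qed.

Lemma matrix_potent_nilpotent n (A : 'M['F_p]_n.+1) m : (1 < m)%N ->
  (forall i, (1 <= i <= n.+1)%N -> (p ^ i - 1 %| m - 1)%N) ->
  exists t, (A ^+ m - A) ^+ t = 0.
Proof.
move=> m_gt1 Dm.
have [//||t /dvdpP[q Dq]] := @dvdp_pow_potent m (char_poly A) m_gt1.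
- by rewrite monic_neq0 ?char_poly_monic.
- by move=> i; rewrite size_char_poly ltnS; exact: Dm.
exists t; have /(congr1 (horner_mx A)) := Dq.
rewrite rmorphM /= Cayley_Hamilton mulr0 rmorphXn rmorphB /= rmorphXn /=.
by rewrite horner_mx_X.
Qed.

(** [A] is multiplication by a generator [w] of the unit group of the field with [p ^ d] elements.
    If [w ^+ m - w] is nilpotent it is zero, so the order [p ^ d - 1] of [w] divides [m - 1]. *)
Lemma exists_field_matrix d : (0 < d)%N ->
  exists A : 'M['F_p]_d, forall m t, (1 < m)%N ->
    (A ^+ m - A) ^+ t = 0 -> (p ^ d - 1 %| m - 1)%N.
Proof.
move=> d_gt0.
have [F chF cardF] := pPrimePowerField pr_p d_gt0.
pose V := pPrimeCharType chF.
have dimV : dim V = d by rewrite -dimvf pprimeChar_dimf cardF pfactorK.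
have /cyclicP[u Du] := field_unit_group_cyclic [set: {unit F}]%G.
have ou : #[u]%g = (p ^ d - 1)%N.
  by rewrite /order -Du card_finField_unit cardF subn1.
(* [dim V] equals [d] only propositionally, so the matrix is built in size [dim V]. *)
suff: exists A : 'M['F_p]_(dim V), forall m t, (1 < m)%N ->
    (A ^+ m - A) ^+ t = 0 -> (p ^ d - 1 %| m - 1)%N by rewrite dimV.
pose w : V := val u.
pose A := lin1_mx (v2r \o amulr w \o r2v).
exists A => m t m_gt1 At.
have AE n (x : V) : v2r x *m A ^+ n = v2r (x * w ^+ n).
  elim: n x => [|n IH] x; first by rewrite !expr0 mulmx1 mulr1.
  by rewrite exprS mulmxA mul_rV_lin1 /= v2rK lfunE /= IH exprS mulrA.
have w_unit : w != 0 by have := valP u; rewrite /= unitfE.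
have wm : w ^+ m - w = 0.
  suff : (w ^+ m - w) ^+ t = 0.
    by move=> /eqP; rewrite expf_eq0 => /andP[_ /eqP].
  have BE n (x : V) : v2r x *m (A ^+ m - A) ^+ n = v2r (x * (w ^+ m - w) ^+ n).
    elim: n x => [|n IH] x; first by rewrite !expr0 mulmx1 mulr1.
    rewrite !exprS mulmxA mulmxBr AE (AE 1%N) expr1 -raddfB /= IH.
    by rewrite mulrA mulrBr.
  apply: (can_inj v2rK); rewrite -[X in v2r X]mul1r -BE At mulmx0 linear0 //.
have um : (u ^+ m.-1)%g = 1%g.
  apply: val_inj; rewrite FinRing.val_unitX; apply: (mulfI w_unit).
  rewrite -[LHS](exprS w) prednK ?(ltnW m_gt1) // [RHS]mulr1.
  by apply/eqP; rewrite -subr_eq0 wm.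
by rewrite -ou -subn1 in um *; rewrite order_dvdn um.
Qed.

End PrimeFieldMatrices.

(** * Extending endomorphisms *)

Local Open Scope classical_set_scope.

Section TorsionArithmetic.
Variable G : zmodType.
Implicit Types x y : G.

Lemma mulrn_modn x n k : x *+ n = 0 -> x *+ (k %% n) = x *+ k.
Proof.
move=> xn; rewrite [in RHS](divn_eq k n) mulrnDr.
by rewrite mulnC mulrnA xn mul0rn add0r.
Qed.

Definition dvdg n x := exists y, x = y *+ n.

Lemma dvdg0 n : dvdg n 0.
Proof. by exists 0; rewrite mul0rn. Qed.
Lemma dvdgD n x y : dvdg n x -> dvdg n y -> dvdg n (x + y).
Proof. by move=> [u ->] [v ->]; exists (u + v); rewrite mulrnDl. Qed.
Lemma dvdgN n x : dvdg n x -> dvdg n (- x).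
Proof. by move=> [u ->]; exists (- u); rewrite mulNrn. Qed.
Lemma dvdgB n x y : dvdg n x -> dvdg n y -> dvdg n (x - y).
Proof. by move=> nx /dvdgN; exact: dvdgD. Qed.
Lemma dvdgMn n x k : dvdg n x -> dvdg n (x *+ k).
Proof. by move=> [u ->]; exists (u *+ k); rewrite mulrnAC. Qed.
Lemma dvdg_mulrn n x : dvdg n (x *+ n).
Proof. by exists x. Qed.
Lemma dvdg_endo n x (f : endo G) : dvdg n x -> dvdg n (f x).
Proof. by move=> [u ->]; exists (f u); rewrite raddfMn. Qed.

Lemma dvdg_trans_sub n x y z :
  dvdg n (x - y) -> dvdg n (y - z) -> dvdg n (x - z).
Proof. by move=> xy /(dvdgD xy); rewrite addrA subrK. Qed.

(* The elements whose classes fill the Ulm factor p^k G[p] / p^(k+1) G[p], whose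
   dimension is the number of cyclic summands of G of order p^(k+1). *)
Definition ulm p k x := dvdg (p ^ k) x /\ x *+ p = 0.

Definition subgroup (H : set G) := H 0 /\ forall x y, H x -> H y -> H (x - y).

Lemma subgroupN H x : subgroup H -> H x -> H (- x).
Proof. by move=> [H0 HB] /(HB _ _ H0); rewrite sub0r. Qed.
Lemma subgroupD H x y : subgroup H -> H x -> H y -> H (x + y).
Proof. by move=> sH Hx /(subgroupN sH) /(sH.2 _ _ Hx); rewrite opprK. Qed.
Lemma subgroupMn H x n : subgroup H -> H x -> H (x *+ n).
Proof.
move=> sH Hx; elim: n => [|n IH]; first exact: sH.1.
by rewrite mulrS; exact: subgroupD.
Qed.

Lemma subgroup_gcdn H x a b : subgroup H -> H (x *+ a) -> H (x *+ b) ->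
  H (x *+ gcdn a b).
Proof.
move=> sH Ha Hb; case: (posnP a) => [->|a_gt0]; first by rewrite gcd0n.
case: (egcdnP b a_gt0) => u v E _.
have -> : x *+ gcdn a b = x *+ (a * u) - x *+ (b * v).
  by rewrite [(a * u)%N]mulnC E mulrnDr mulnC addrC addKr.
by rewrite !mulrnA; apply: sH.2; exact: subgroupMn.
Qed.

Lemma mulrn_gcdn x a b : x *+ a = 0 -> x *+ b = 0 -> x *+ gcdn a b = 0.
Proof.
apply: (@subgroup_gcdn [set y | y = 0]).
by split=> // y z /= -> ->; rewrite subrr.
Qed.

Lemma maximal_subgroup_avoiding (H : set G) x : subgroup H -> ~ H x ->
  exists M, [/\ subgroup M, H `<=` M, ~ M x &
    forall K, subgroup K -> M `<=` K -> ~ K x -> K `<=` M].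
Proof.
move=> sH Hx.
(* The union of the empty chain is empty, so [P] must admit the empty set; comparison with [H] rules
   it out as a maximal element. *)
pose P (A : set G) := A = set0 \/ [/\ subgroup A, H `<=` A & ~ A x].
have [F FP totF|A [PA maxA]] := @Zorn_bigcup _ P.
  have [[B [FB B0]]|none] := pselect (exists B, F B /\ B !=set0); last first.
    left; apply/seteqP; split=> // y [B FB By]; case: none; exists B.
    by split=> //; exists y.
  have good C : F C -> C !=set0 -> [/\ subgroup C, H `<=` C & ~ C x].
    by move=> /FP[->|//] [y].
  have [[B00 _] HB _] := good B FB B0.
  right; split; first split=> [|y z [C FC Cy] [D FD Dz]].
  - by exists B.
  - have [CD|DC] := totF C D FC FD.
      have [[_ DB] _ _] := good D FD (ex_intro _ z Dz).
      by exists D => //; apply: DB => //; exact: CD.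
    have [[_ CB] _ _] := good C FC (ex_intro _ y Cy).
    by exists C => //; apply: CB => //; exact: DC.
  - by move=> y Hy; exists B => //; exact: HB.
  - move=> [C FC Cx]; by have [_ _ nCx] := good C FC (ex_intro _ x Cx).
have [A0|[sA HA Ax]] := PA.
  have := maxA H; rewrite A0 => nPH; exfalso; apply: nPH; last first.
    by right; split.
  by split=> [y []|/(_ 0 sH.1) []].
exists A; split=> // K sK AK Kx y Ky; apply: contrapT => nAy.
apply: (maxA K); last by right; split=> //; exact: subset_trans AK.
by split=> // KA; apply: nAy; exact: KA.
Qed.

(* With x = p^k y, a subgroup M maximal among those containing H and avoiding x
   satisfies G = <y> + M and <y> :&: M = <p^(k+1) y>. *)
Lemma endo_extend p k (H : set G) x z : prime p -> subgroup H ->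
  (forall g, H (g *+ p ^ k.+1)) -> ~ H x -> ulm p k x -> ulm p k z ->
  exists f : endo G, [/\ f x = z, forall h, H h -> f h = 0 &
    forall g, g *+ p = 0 -> exists c, f g = z *+ c].
Proof.
move=> pr_p sH Hp Hx [[y Dx] xp] [[w Dz] zp].
have [M [sM HM Mx maxM]] := maximal_subgroup_avoiding sH Hx.
have [M0 MB] := sM; have MD := subgroupD sM; have MN := subgroupN sM.
have MMn g n : M g -> M (g *+ n) by exact: subgroupMn.
have wp : w *+ p ^ k.+1 = 0 by rewrite expnSr mulrnA -Dz.
have Mp g : M (g *+ p ^ k.+1) by exact/HM/Hp.
have inv_p n : ~~ (p %| n)%N -> exists u, (u * n = 1 %[mod p])%N.
  rewrite -prime_coprime // coprime_sym => /eqP cop.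
  case: n cop => [|n]; first by rewrite gcd0n => p1; rewrite p1 in pr_p.
  move=> /eqP cop; have [u v E _] := egcdnP p (isT : (0 < n.+1)%N).
  by exists u; rewrite E (eqP cop) modnMDl.
(* The gcd of [p ^ k.+1] and [c] is some [p ^ j] with [y *+ p ^ j] in [M]; [j <= k] would put
   [x = y *+ p ^ k] in [M]. *)
have My c : M (y *+ c) -> (p ^ k.+1 %| c)%N.
  move=> Myc; have /(dvdn_pfactor _ _ pr_p)[j jk Dg] := dvdn_gcdl (p ^ k.+1) c.
  have : M (y *+ p ^ j) by rewrite -Dg; exact: subgroup_gcdn.
  have [jk'|kj _] := leqP j k.
    by move=> /(MMn _ (p ^ (k - j))%N); rewrite -mulrnA -expnD subnKC // -Dx.
  by rewrite (_ : k.+1 = j) -?Dg ?dvdn_gcdr //; apply/eqP; rewrite eqn_leq kj.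
have p_gt0 := prime_gt0 pr_p.
have pM g c : M (g *+ p - y *+ c) -> (p %| c)%N.
  move=> /(MMn _ (p ^ k)%N); rewrite mulrnBl -mulrnA -expnS => /(MB _ _ (Mp g)).
  rewrite opprD addNKr opprK -mulrnA => /My.
  by rewrite expnSr mulnC dvdn_pmul2r // expn_gt0 p_gt0.
(* If [g] is outside [M], then [M + <g>] contains [x] by maximality. So [x] is congruent to [g *+ i]
   with [i] prime to [p], and inverting [i] modulo [p] expresses [g] through [x], a multiple of
   [y]. *)
have MY1 g : M (g *+ p) -> exists c, M (g - y *+ c).
  move=> Mgp; have [Mg|nMg] := pselect (M g).
    by exists 0%N; rewrite mulr0n subr0.
  pose K : set G := [set h | exists i, M (h - g *+ i)].
  have sK : subgroup K.
    split=> [|h h' [i Mi] [i' Mi']]; first by exists 0%N; rewrite mulr0n subr0.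
    (* Coefficients are naturals: [p.-1] stands for [-1], as [g *+ p] is in [M]. *)
    exists (i + i' * p.-1)%N.
    have -> : h - h' - g *+ (i + i' * p.-1) =
        h - g *+ i - (h' - g *+ i') - g *+ p *+ i'.
      have -> : g *+ p *+ i' = g *+ i' + g *+ (i' * p.-1).
        by rewrite -mulrnA -mulrnDr -mulnS prednK // mulnC.
      by rewrite mulrnDr !opprD opprK !addrA addrK [h - h' - _]addrAC.
    exact: MB _ _ (MB _ _ Mi Mi') (MMn _ _ Mgp).
  have [i Mi] : K x.
    apply: contrapT => nKx; apply: nMg; apply: (maxM K) => //.
      by move=> h Mh; exists 0%N; rewrite mulr0n subr0.
    by exists 1%N; rewrite mulr1n subrr.
  have [u ui] : exists u, (u * i = 1 %[mod p])%N.
    apply: inv_p; apply/negP => /dvdnP[j Dj]; apply: Mx.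
    rewrite -(subrK (g *+ i) x); apply: MD => //.
    by rewrite Dj mulnC mulrnA; exact: MMn.
  exists (p ^ k * u)%N; rewrite mulrnA -Dx.
  have -> : g - x *+ u = - ((x - g *+ i) *+ u) - g *+ (u * i) + g.
    rewrite mulrnBl -mulrnA [(i * u)%N]mulnC opprB.
    by rewrite [_ - _ - _]addrAC subrr add0r addrC.
  rewrite -addrA; apply: MD; first by apply/MN/MMn.
  rewrite (divn_eq (u * i) p) ui mulrnDr modn_small ?prime_gt1 // mulr1n.
  by rewrite opprD subrK mulnC mulrnA; apply/MN/MMn.
have MY g : exists c, M (g - y *+ c).
  (* Induction on the power of [p] sending [h] into [M]: the coefficient found for [h *+ p] is
     divisible by [p], and [MY1] handles what remains. *)
  suff: forall j h, M (h *+ p ^ j) -> exists c, M (h - y *+ c).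
    by apply; exact: Mp.
  elim=> [|j IH] h Mh.
    by exists 0%N; rewrite mulr0n subr0 -[h]mulr1n -(expn0 p).
  have [c Mc] : exists c, M (h *+ p - y *+ c).
    by apply: IH; rewrite -mulrnA -expnS.
  have /dvdnP[c' Dc] := pM _ _ Mc.
  have [|b Mb] := MY1 (h - y *+ c').
    by rewrite mulrnBl -mulrnA -Dc.
  by exists (c' + b)%N; rewrite mulrnDr opprD addrA.
(* The coefficient of [y] is determined only modulo [p ^ k.+1], but this kills [w]; hence
   [w *+ coef g] is well defined and additive in [g]. *)
pose coef g := sval (cid (MY g)).
have coefP g c : M (g - y *+ c) -> w *+ coef g = w *+ c.
  rewrite /coef; case: (cid _) => /= b Mb Mc.
  wlog lbc : b c Mb Mc / (b <= c)%N.
    by move=> W; have [|/ltnW] := leqP b c => bc; [|apply/esym]; exact: W.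
  have /My/dvdnP[q Dq] : M (y *+ (c - b)).
    have -> : y *+ (c - b) = (g - y *+ b) - (g - y *+ c).
      by rewrite mulrnBr // opprB [RHS]addrC subrKA.
    exact: MB.
  by rewrite -(subnKC lbc) Dq mulrnDr mulnC mulrnA wp mul0rn addr0.
have coef_spec g : M (g - y *+ coef g) by rewrite /coef; case: (cid _).
pose f g := w *+ coef g.
have f0 : f 0 = 0 by rewrite /f (@coefP _ 0%N) // mulr0n subrr.
have fD : {morph f : g h / g + h}.
  move=> g h; rewrite /f -mulrnDr; apply: coefP.
  by rewrite mulrnDr opprD addrACA; exact: MD.
pose F : endo G := HB.pack f (GRing.isNmodMorphism.Build G G f (conj f0 fD)).
exists F; split=> /= [|h Hh|g gp].
- by rewrite /f (@coefP _ (p ^ k)%N) -?Dz // -Dx subrr.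
- by rewrite /f (@coefP _ 0%N) // mulr0n subr0; exact: HM.
(* For [g] killed by [p], the coefficient is divisible by [p ^ k], and [w *+ p ^ k = z]. *)
- have /My : M (y *+ (coef g * p)).
    rewrite mulrnA -[_ *+ p]opprK; apply: MN; rewrite -sub0r -gp -mulrnBl.
    exact: MMn.
  rewrite expnSr dvdn_pmul2r // => /dvdnP[q Dq].
  by exists q; rewrite /f Dq mulnC mulrnA -Dz.
Qed.

End TorsionArithmetic.

(** * Free families in the Ulm factors *)

Section UlmFamilies.
Variables (p : nat) (pr_p : prime p) (G : zmodType).
Implicit Types (x z : G) (d k : nat).

Lemma mulrFpD x (a b : 'F_p) : x *+ p = 0 -> x *+ (a + b)%R = x *+ a + x *+ b.
Proof.
move=> xp; rewrite -mulrnDr -(mulrn_modn (a + b)%N xp).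
by rewrite -[X in (_ %% X)%N](Fp_cast pr_p).
Qed.

Lemma mulrFpM x (a b : 'F_p) : x *+ p = 0 -> x *+ (a * b)%R = x *+ a *+ b.
Proof.
move=> xp; rewrite -mulrnA -(mulrn_modn (a * b)%N xp).
by rewrite -[X in (_ %% X)%N](Fp_cast pr_p).
Qed.

Definition comb d (X : 'I_d -> G) (c : 'rV['F_p]_d) : G :=
  \sum_i X i *+ (c 0 i : 'F_p).

(** Linear independence over ['F_p] in the [k]-th Ulm factor. *)
Definition ulm_free k d (X : 'I_d -> G) :=
  (forall i, ulm p k (X i)) /\
  forall c, dvdg (p ^ k.+1) (comb X c) -> c = 0.

Lemma endo_comb (f : endo G) d (X : 'I_d -> G) c :
  f (comb X c) = comb (f \o X) c.
Proof. by rewrite raddf_sum; apply: eq_bigr => i _; rewrite raddfMn. Qed.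

Section Torsion.
Variables (d : nat) (X : 'I_d -> G) (Xp : forall i, X i *+ p = 0).
Implicit Type c : 'rV['F_p]_d.

Lemma comb_torsion c : comb X c *+ p = 0.
Proof. by rewrite -sumrMnl big1 // => i _; rewrite mulrnAC Xp mul0rn. Qed.

Lemma combD c c' : comb X (c + c') = comb X c + comb X c'.
Proof. by rewrite -big_split; apply: eq_bigr => i _; rewrite mxE mulrFpD. Qed.

Lemma comb0 : comb X 0 = 0.
Proof. by rewrite /comb big1 // => i _; rewrite mxE. Qed.

Lemma combB c c' : comb X (c - c') = comb X c - comb X c'.
Proof. by apply: (addIr (comb X c')); rewrite -combD !subrK. Qed.

Lemma combZ (a : 'F_p) c : comb X (a *: c) = comb X c *+ a.
Proof.
rewrite -sumrMnl; apply: eq_bigr => i _.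
by rewrite mxE mulrC mulrFpM.
Qed.

Lemma comb_delta i : comb X (delta_mx 0 i) = X i.
Proof.
rewrite /comb (bigD1 i) //= big1 ?addr0 => [|j ji]; rewrite mxE eqxx /=.
  by rewrite eqxx /= modn_small ?mulr1n.
by rewrite (negPf ji).
Qed.

Lemma comb_mulmx n (c : 'rV['F_p]_n) (A : 'M_(n, d)) :
  comb X (c *m A) = comb (fun i => comb X (row i A)) c.
Proof.
rewrite mulmx_sum_row (big_morph _ combD comb0).
by apply: eq_bigr => i _; rewrite combZ.
Qed.

Lemma ulm_comb k c : (forall i, ulm p k (X i)) -> ulm p k (comb X c).
Proof.
move=> uX; split; last exact: comb_torsion.
apply: (big_ind (dvdg (p ^ k))) => [|y z|i _]; first exact: dvdg0.
  exact: dvdgD.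
by apply: dvdgMn; have [] := uX i.
Qed.

End Torsion.

Lemma ulm_free_torsion k d (X : 'I_d -> G) : ulm_free k X ->
  forall i, X i *+ p = 0.
Proof. by move=> [uX _] i; have [] := uX i. Qed.

Lemma ulm_free_sub k d n (X : 'I_d -> G) : ulm_free k X -> (n <= d)%N ->
  exists Y : 'I_n -> G, ulm_free k Y.
Proof.
move=> fX nd; have Xp := ulm_free_torsion fX; have [uX X0] := fX.
exists (X \o widen_ord nd); split=> [i|c]; first exact: uX.
pose P : 'M['F_p]_(n, d) := \matrix_i delta_mx 0 (widen_ord nd i).
have -> : comb (X \o widen_ord nd) c = comb X (c *m P).
  rewrite comb_mulmx //; apply: eq_bigr => i _.
  by rewrite rowK comb_delta.
move=> /X0 /rowP cP; apply/rowP => i; have := cP (widen_ord nd i).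
rewrite !mxE (bigD1 i) //= big1 ?addr0 => [|j ji]; rewrite !mxE eqxx /=.
  by rewrite eqxx mulr1.
have -> : (widen_ord nd i == widen_ord nd j) = false.
  by rewrite eq_sym; apply: contraNF ji => /eqP/(congr1 val)/= /val_inj->.
by rewrite mulr0.
Qed.

(** A longest free family spans: adjoining [z] creates a relation, whose coefficient at [z] is
    nonzero because [X] is free, and which can be solved for [z]. *)
Lemma maximal_ulm_free k N :
  (forall d (X : 'I_d -> G), ulm_free k X -> (d <= N)%N) ->
  exists n (X : 'I_n -> G), ulm_free k X /\
    forall z, ulm p k z -> exists c, dvdg (p ^ k.+1) (z - comb X c).
Proof.
move=> ubN.
have ex0 : exists d, `[< exists X : 'I_d -> G, ulm_free k X >].
  exists 0%N; apply/asboolP; exists (fun=> 0); split=> [[]//|c _].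
  by rewrite [c]thinmx0.
have ub d : `[< exists X : 'I_d -> G, ulm_free k X >] -> (d <= N)%N.
  by move=> /asboolP[X /ubN].
case: (ex_maxnP ex0 ub) => n /asboolP[X fX] maxn; exists n, X; split=> // z uz.
have Xp := ulm_free_torsion fX; have [uX X0] := fX.
pose Y (i : 'I_n.+1) := if unlift ord0 i is Some j then X j else z.
have uY i : ulm p k (Y i) by rewrite /Y; case: unliftP.
have YE c : comb Y c = z *+ c 0 ord0 + comb X (\row_i c 0 (lift ord0 i)).
  rewrite /comb big_ord_recl /Y unlift_none; congr (_ + _).
  by apply: eq_bigr => i _; rewrite liftK mxE.
have [c Yc c0] : exists2 c, dvdg (p ^ k.+1) (comb Y c) & c <> 0.
  apply: contrapT => nex.
  suff /asboolT /maxn : exists Y : 'I_n.+1 -> G, ulm_free k Y.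
    by rewrite ltnn.
  by exists Y; split=> // c Yc; apply: contrapT => nc; apply: nex; exists c.
have Yp i : Y i *+ p = 0 by have [] := uY i.
have [c00|c00] := eqVneq (c 0 ord0) 0.
  case: c0; move: Yc; rewrite YE c00 mulr0n add0r => /X0/rowP c1.
  apply/rowP => i; rewrite mxE; have [j ->|->//] := unliftP ord0 i.
  by have := c1 j; rewrite !mxE.
pose b := (c 0 ord0)^-1 *: c.
have : dvdg (p ^ k.+1) (comb Y b) by rewrite combZ //; exact: dvdgMn.
rewrite YE mxE mulVf // /= modn_small ?mulr1n //.
set b' := \row_i _ => zb'; exists (- b').
by rewrite -[- b']sub0r combB // comb0 sub0r opprK.
Qed.

(* Row vectors are coordinates, so composition reverses the matrix product. *)
Definition realizes k d (X : 'I_d -> G) (f : endo G) (A : 'M['F_p]_d) :=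
  forall c, dvdg (p ^ k.+1) (f (comb X c) - comb X (c *m A)).

Section Realization.
Variables (k d : nat) (X : 'I_d -> G).
Hypothesis (Xp : forall i, X i *+ p = 0).
Implicit Types (f g : endo G) (A B : 'M['F_p]_d).

Lemma realizes1 : realizes k X 1 1.
Proof. by move=> c; rewrite mulmx1 /= subrr; exact: dvdg0. Qed.

Lemma realizesM f g A B :
  realizes k X f A -> realizes k X g B -> realizes k X (f * g) (B *m A).
Proof.
move=> fA gB c; rewrite mulmxA /=; apply: dvdg_trans_sub (fA _).
by rewrite -raddfB; exact: dvdg_endo.
Qed.

Lemma realizesB f g A B :
  realizes k X f A -> realizes k X g B -> realizes k X (f - g) (A - B).
Proof.
move=> fA gB c; rewrite mulmxBr combB //.
have -> : (f - g) (comb X c) - (comb X (c *m A) - comb X (c *m B)) =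
    (f (comb X c) - comb X (c *m A)) - (g (comb X c) - comb X (c *m B)).
  by rewrite !opprB addrACA [RHS]addrACA [- _ - _ in RHS]addrC.
exact: dvdgB.
Qed.

Lemma realizesX f A n : realizes k X f A -> realizes k X (f ^+ n) (A ^+ n).
Proof.
move=> fA; elim: n => [|n IH]; first by rewrite !expr0; exact: realizes1.
by rewrite exprS exprSr; exact: realizesM.
Qed.

Lemma realizes_potent f A m t : realizes k X f A ->
  realizes k X ((f ^+ m - f) ^+ t) ((A ^+ m - A) ^+ t).
Proof. by move=> fA; apply/realizesX/realizesB => //; exact: realizesX. Qed.

Lemma realizes_rows f A :
  (forall i, dvdg (p ^ k.+1) (f (X i) - comb X (row i A))) -> realizes k X f A.
Proof.
move=> fA c; rewrite endo_comb comb_mulmx // -sumrB.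
apply: big_ind => [|y z|i _]; [exact: dvdg0 | exact: dvdgD |].
by rewrite -mulrnBl; exact/dvdgMn/fA.
Qed.

End Realization.

(** [f] is a sum of extensions, the [i]-th prescribed at [X i] and zero on [H i], the span of the
    other members plus [p ^ k.+1 G]. The control of [f] on all of [G[p]] is what makes the shift
    nilpotent modulo the radical later. *)
Lemma endo_of_matrix k d (X : 'I_d -> G) (A : 'M['F_p]_d) : ulm_free k X ->
  exists f : endo G, (forall i, f (X i) = comb X (row i A)) /\
    (forall g, g *+ p = 0 -> exists c, f g = comb X c).
Proof.
move=> fX; have Xp := ulm_free_torsion fX; have [uX X0] := fX.
pose H i : set G :=
  [set h | exists (c : 'rV['F_p]_d) g,
             c 0 i = 0 /\ h = comb X c + g *+ p ^ k.+1].
have sH i : subgroup (H i).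
  split=> [|h h' [c [g [ci ->]]] [c' [g' [ci' ->]]]].
    by exists 0, 0; rewrite mxE comb0 mul0rn addr0; split.
  exists (c - c'), (g - g'); rewrite !mxE ci ci' subrr; split=> //.
  by rewrite combB // mulrnBl opprD addrACA.
have Hp i g : H i (g *+ p ^ k.+1).
  by exists 0, g; rewrite mxE comb0 add0r; split.
have HX i j : j != i -> H i (X j).
  move=> ji; exists (delta_mx 0 j), 0; rewrite comb_delta mul0rn addr0.
  by rewrite mxE eqxx /= eq_sym (negPf ji); split.
have nHX i : ~ H i (X i).
  move=> [c [g [ci Xi]]]; have : comb X (delta_mx 0 i - c) = g *+ p ^ k.+1.
    by rewrite combB // comb_delta Xi addrC addKr.
  move=> E; have /X0/rowP/(_ i) : dvdg (p ^ k.+1) (comb X (delta_mx 0 i - c)).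
    by rewrite E; exact: dvdg_mulrn.
  by rewrite !mxE ci !eqxx subr0 => /eqP; rewrite oner_eq0.
have /choice[F FP] i : exists f : endo G, [/\ f (X i) = comb X (row i A),
    forall h, H i h -> f h = 0 &
    forall g, g *+ p = 0 -> exists c, f g = comb X (row i A) *+ c].
  exact: endo_extend pr_p (sH i) (Hp i) (nHX i) (uX i) (ulm_comb Xp _ uX).
have sumE g : (\sum_i F i) g = \sum_i F i g.
  by apply: (big_morph (fun f : endo G => f g)).
exists (\sum_i F i); split=> [i|g gp].
- rewrite sumE (bigD1 i) //= big1 => [|j ji].
    by have [-> _ _] := FP i; rewrite addr0.
  by have [_ F0 _] := FP j; apply: F0; apply: HX; rewrite eq_sym.
- rewrite sumE; apply: (big_ind (fun y => exists c, y = comb X c))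
    => [|_ _ [c ->] [c' ->]|i _].
  + by exists 0; rewrite comb0.
  + by exists (c + c'); rewrite combD.
  + have [_ _ /(_ g gp)[c ->]] := FP i.
    exists ((c%:R : 'F_p) *: row i A); rewrite combZ // val_Fp_nat //.
    by rewrite mulrn_modn // comb_torsion.
Qed.

Lemma ulm_free_potent k d (X : 'I_d -> G) m i : ulm_free k X -> (1 < m)%N ->
  (forall f : endo G, nilpotent_elt (f ^+ m - f)) -> (1 <= i <= d)%N ->
  (p ^ i - 1 %| m - 1)%N.
Proof.
move=> fX m_gt1 nil_f /andP[i_gt0 id].
have [Y fY] := ulm_free_sub fX id; have Yp := ulm_free_torsion fY.
have [A AP] := exists_field_matrix pr_p i_gt0.
have [f [fA _]] := endo_of_matrix A fY.
have rfA : realizes k Y f A.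
  by apply: realizes_rows => // j; rewrite fA subrr; exact: dvdg0.
have /nilpotent_eltP[t ft] := nil_f f.
apply: (AP m t m_gt1); apply/row_matrixP => j; rewrite row0.
have := realizes_potent Yp m t rfA (delta_mx 0 j).
rewrite ft /= sub0r => /dvdgN; rewrite opprK => /(proj2 fY).
by rewrite rowE.
Qed.

Lemma potent_mod_ulm k m (f : endo G) : (1 < m)%N ->
  (forall d (X : 'I_d -> G), ulm_free k X -> forall i, (1 <= i <= d)%N ->
    (p ^ i - 1 %| m - 1)%N) ->
  exists t, forall z, ulm p k z -> dvdg (p ^ k.+1) (((f ^+ m - f) ^+ t) z).
Proof.
move=> m_gt1 Dm.
(* As [d < p ^ d], the divisibility bounds the dimension of the Ulm factor. *)
have ubd d (X : 'I_d -> G) : ulm_free k X -> (d <= m - 1)%N.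
  case: d X => // d X /Dm/(_ d.+1) H.
  have /dvdn_leq : (p ^ d.+1 - 1 %| m - 1)%N by apply: H; rewrite leqnn.
  have := ltn_expl d.+1 (prime_gt1 pr_p); lia.
have [n [X [fX spanX]]] := maximal_ulm_free ubd.
have Xp := ulm_free_torsion fX; have [uX X0] := fX.
case: n X fX spanX Xp uX X0 => [|n] X fX spanX Xp uX X0.
  exists 0%N => z /spanX[c].
  by rewrite [c]thinmx0 comb0 subr0.
have /choice[a aP] i : exists c, dvdg (p ^ k.+1) (f (X i) - comb X c).
  apply: spanX; split; first exact/dvdg_endo/(uX i).1.
  by rewrite -raddfMn Xp raddf0.
have rf : realizes k X f (\matrix_i a i).
  by apply: realizes_rows => // i; rewrite rowK.
have [t At] := matrix_potent_nilpotent pr_p (\matrix_i a i) m_gt1 (Dm _ _ fX).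
exists t => z /spanX[c zc].
have := realizes_potent Xp m t rf c; rewrite At mulmx0 comb0 subr0 => H.
by rewrite -[z](subrK (comb X c)) raddfD; apply: dvdgD => //; exact: dvdg_endo.
Qed.

End UlmFamilies.

(** * Groups of bounded exponent *)

Definition bounded_exponent (n : nat) (G : zmodType) := forall x : G, x *+ n = 0.

Definition ulm_bound (m : nat) (G : zmodType) :=
  forall p k d (X : 'I_d -> G), prime p -> ulm_free p k X ->
  forall i, (1 <= i <= d)%N -> (p ^ i - 1 %| m - 1)%N.

Lemma natr_endoE (G : zmodType) n (x : G) : (n%:R : endo G) x = x *+ n.
Proof. by elim: n => [|n IH]; rewrite ?mulr0n // mulrS [RHS]mulrS -IH. Qed.

Lemma finite_bounded_exponent (G : zmodType) : finite_set [set: G] ->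
  exists2 n, (0 < n)%N & bounded_exponent n G.
Proof.
move=> finG.
have /choice[o oP] (x : G) : exists n, (0 < n)%N /\ x *+ n = 0.
  (* For [x] of infinite order, the multiples of [x] would embed [nat] into [G]. *)
  apply: contrapT => tf; apply: infinite_nat.
  have -> : [set: nat] = (fun i => x *+ i) @^-1` [set: G].
    by rewrite preimage_setT.
  apply: finite_preimage finG => i j _ _.
  wlog ij : i j / (i <= j)%N.
    by move=> W; have [|/ltnW] := leqP i j => h E; [|apply/esym]; exact: W.
  move=> E; apply/eqP; rewrite eqn_leq ij leqNgt; apply/negP => lij; apply: tf.
  by exists (j - i)%N; rewrite subn_gt0 mulrnBr // E subrr.
have /finite_seqP[s sE] := finG.
exists (\prod_(x <- s) o x)%N.
  by rewrite prodn_gt0 // => x; have [] := oP x.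
move=> x; have : [set: G] x by []; rewrite sE /= => xs.
by rewrite (big_rem x) //= mulrnA (oP x).2 mul0rn.
Qed.

Lemma potent_bounded_exponent (G : zmodType) m : (1 < m)%N ->
  (forall f : endo G, nilpotent_elt (f ^+ m - f)) ->
  exists2 n, (0 < n)%N & bounded_exponent n G.
Proof.
move=> m_gt1 /(_ 2%:R)/nilpotent_eltP[t].
have lt2 : (2 < 2 ^ m)%N by rewrite -{1}(expn1 2) ltn_exp2l.
rewrite -natrX -natrB ?(ltnW lt2) // -natrX => n0.
exists ((2 ^ m - 2) ^ t)%N; first by rewrite expn_gt0 subn_gt0 lt2.
by move=> x; rewrite -natr_endoE n0.
Qed.

Section BoundedExponent.
Variables (G : zmodType) (n : nat).
Hypotheses (n_gt0 : (0 < n)%N) (nG : bounded_exponent n G).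

Lemma ulm_logn_eq0 p (x : G) : prime p -> ulm p (logn p n) x -> x = 0.
Proof.
move=> pr_p [[y Dx] xp]; have [n' pn' Dn] := pfactor_coprime pr_p n_gt0.
rewrite -[x]mulr1n -(eqP pn'); apply: mulrn_gcdn => //.
by rewrite Dx -mulrnA mulnC -Dn nG.
Qed.

(** The layers [ulm p k] descend from [G[p]] at [k = 0] to zero at [k = logn p n]; [P] is carried
    back up. *)
Lemma ulm_filtration_ind p (P : set (set G)) : prime p -> P [set 0] ->
  (forall k, P (ulm p k.+1) -> P (ulm p k)) -> P [set x | x *+ p = 0].
Proof.
move=> pr_p P0 PS.
have -> : [set x : G | x *+ p = 0] = ulm p 0.
  apply/seteqP; split=> x; last by case.
  by split=> //; exists x; rewrite expn0.
suff H j : P (ulm p (logn p n - j)) by have := H (logn p n); rewrite subnn.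
elim: j => [|j IH].
  rewrite subn0 (_ : ulm _ _ = [set 0]) //; apply/seteqP; split=> x.
    exact: ulm_logn_eq0.
  by move=> /= ->; split; [exact: dvdg0 | rewrite mul0rn].
have [jl|lj] := leqP (logn p n) j.
  by have -> : (logn p n - j.+1 = logn p n - j)%N by lia.
by apply: PS; rewrite -subSn.
Qed.

Lemma torsion_ind (P : set (set G)) : P [set 0] ->
  (forall p, prime p -> P [set x | x *+ p = 0]) ->
  (forall a b, P [set x | x *+ a = 0] -> P [set x | x *+ b = 0] ->
    P [set x | x *+ (a * b) = 0]) ->
  P [set: G].
Proof.
move=> P0 Pp PM; have -> : [set: G] = [set x | x *+ n = 0].
  by apply/seteqP; split=> x //= _; exact: nG.
elim/ltn_ind: (n) n_gt0 => a IH a_gt0.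
have [a1|a_gt1] := leqP a 1.
  suff -> : [set x : G | x *+ a = 0] = [set 0] by [].
  by have -> : a = 1%N by lia.
rewrite -(divnK (pdiv_dvd a)); apply: PM; last exact/Pp/pdiv_prime.
have pr_q := pdiv_prime a_gt1; apply: IH.
  by rewrite ltn_Pdiv // prime_gt1.
by rewrite divn_gt0 ?prime_gt0 // dvdn_leq // pdiv_dvd.
Qed.

(** Some power of [f] pushes each layer into the next; exponents add along the layers and along the
    prime factors of [n]. *)
Lemma nilpotent_on_ulm (f : endo G) :
  (forall p k, prime p -> exists t, forall x, ulm p k x ->
    dvdg (p ^ k.+1) ((f ^+ t) x)) -> nilpotent_elt f.
Proof.
move=> fulm.
pose P : set (set G) := [set A | exists t, forall x, A x -> (f ^+ t) x = 0].
suff [t ft] : P [set: G].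
  by apply/nilpotent_eltP; exists t; apply: endoP => x; exact: ft.
have P0 : P [set 0] by exists 0%N => x ->; rewrite raddf0.
apply: torsion_ind => // [p pr_p|a b [s fs] [t ft]].
- apply: ulm_filtration_ind => // k [s fs].
  have [t ft] := fulm p k pr_p; exists (s + t)%N => x ux.
  rewrite exprD; apply: fs; split; first exact: ft.
  by rewrite -raddfMn ux.2 raddf0.
- exists (t + s)%N => x /= xab; rewrite exprD; apply: ft => /=.
  by rewrite -raddfMn; apply: fs; rewrite /= -mulrnA mulnC.
Qed.

Lemma potent_of_ulm_bound m (f : endo G) : (1 < m)%N -> ulm_bound m G ->
  nilpotent_elt (f ^+ m - f).
Proof.
move=> m_gt1 Dm; apply: nilpotent_on_ulm => p k pr_p.
apply: potent_mod_ulm => // d X fX i; exact: Dm fX i.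
Qed.

(** Each layer is covered by the finitely many combinations of a spanning family, translated by the
    next layer. *)
Lemma finite_of_ulm_bound m : (1 < m)%N -> ulm_bound m G -> finite_set [set: G].
Proof.
move=> m_gt1 Dm; apply: (@torsion_ind (@finite_set G)); first exact: finite_set1.
- move=> p pr_p; apply: (@ulm_filtration_ind p (@finite_set G)) => //.
  move=> k fink.
  have ubd d (X : 'I_d -> G) : ulm_free p k X -> (d <= m - 1)%N.
    case: d X => // d X /(Dm _ _ _ _ pr_p)/(_ d.+1) H.
    have /dvdn_leq : (p ^ d.+1 - 1 %| m - 1)%N by apply: H; rewrite leqnn.
    have := ltn_expl d.+1 (prime_gt1 pr_p); lia.
  have [r [X [fX spanX]]] := maximal_ulm_free pr_p ubd.
  have Xp := ulm_free_torsion fX; have [uX _] := fX.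
  apply: (sub_finite_set _ (finite_image2 (fun c y => comb X c + y)
    (@finite_finset _ [set: 'rV['F_p]_r]) fink)).
  move=> z uz; have [c zc] := spanX z uz.
  exists c => //; exists (z - comb X c); last by rewrite addrC subrK.
  by split=> //; rewrite mulrnBl uz.2 comb_torsion // subrr.
- move=> a b fina finb.
  (* [s] is a section of multiplication by [b], set to zero off the image; [x] is then [s (x *+ b)]
     plus an element killed by [b]. *)
  have /choice[s sP] (y : G) : exists x, (exists z, z *+ b = y) -> x *+ b = y.
    have [[x xy]|ny] := pselect (exists z, z *+ b = y); first by exists x.
    by exists 0.
  apply: (sub_finite_set _ (finite_image2 (fun y x => s y + x) fina finb)).
  move=> x /= xab; exists (x *+ b); first by rewrite /= -mulrnA mulnC.
  exists (x - s (x *+ b)); last by rewrite addrC subrK.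
  by rewrite /= mulrnBl sP ?subrr //; exists x.
Qed.

End BoundedExponent.

(** * The Jacobson radical of the endomorphism ring *)

Section JacobsonRadical.
Variables (p N : nat) (pr_p : prime p) (H : zmodType).
Hypothesis pH : bounded_exponent (p ^ N) H.

Let pN_gt0 : (0 < p ^ N)%N. Proof. by rewrite expn_gt0 prime_gt0. Qed.

Lemma ulm_other_prime q k (x : H) : prime q -> q != p -> ulm q k x -> x = 0.
Proof.
move=> pr_q qp [_ xq]; rewrite -[x]mulr1n.
have /eqP <- : coprime q (p ^ N).
  by rewrite coprimeXr // prime_coprime // dvdn_prime2.
exact: mulrn_gcdn.
Qed.

Lemma nilpotent_on_ulm_primary (f : endo H) :
  (forall k, exists t, forall x, ulm p k x -> dvdg (p ^ k.+1) ((f ^+ t) x)) ->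
  nilpotent_elt f.
Proof.
move=> fulm; apply: (nilpotent_on_ulm pN_gt0 pH) => q k pr_q.
have [->|qp] := eqVneq q p; first exact: fulm.
by exists 0%N => x /(ulm_other_prime pr_q qp) ->; rewrite raddf0; exact: dvdg0.
Qed.

(* The annihilator of a nonzero element of an Ulm factor is a maximal left
   ideal, because the endomorphisms act transitively on these elements. *)
Lemma jacobson_ulm (f : endo H) k x : jacobson f -> ulm p k x ->
  dvdg (p ^ k.+1) (f x).
Proof.
move=> Jf ux.
have [px|npx] := pselect (dvdg (p ^ k.+1) x); first exact: dvdg_endo.
apply: (Jf [set s : endo H | dvdg (p ^ k.+1) (s x)]); split.
- split=> [|s t|s t] /=; [exact: dvdg0 | exact: dvdgD | exact: dvdg_endo].
- by move=> MT; apply: npx; have : [set: endo H] 1 by []; rewrite -MT.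
move=> I [I0 ID IM] MI.
have [IN|] := pselect (I `<=` [set s : endo H | dvdg (p ^ k.+1) (s x)]).
  by left; apply/seteqP.
move=> /existsNP[s /not_implyP[Is /= nsx]]; right.
have us : ulm p k (s x).
  by split; [exact/dvdg_endo/ux.1 | rewrite -raddfMn ux.2 raddf0].
have sq : subgroup (dvdg (p ^ k.+1) : set H).
  by split=> [|y z]; [exact: dvdg0 | exact: dvdgB].
(* [g] carries [s x] back to [x], so [1 - g * s] lies in the annihilator, hence in [I]. *)
have [g [gs _ _]] := endo_extend pr_p sq (dvdg_mulrn _) nsx us ux.
have I1 : I 1.
  rewrite -(subrK (g * s) 1); apply: ID; last exact: IM.
  by apply: MI; rewrite /= gs subrr; exact: dvdg0.
by apply/seteqP; split=> // t _; rewrite -[t]mulr1; exact: IM.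
Qed.

(** If a maximal left ideal [M] missed [f], then [1 = m + s * f] with [m] in [M]. Here [s * f] is
    nilpotent, so the geometric series inverts [m], which is absurd. *)
Lemma ulm_jacobson (f : endo H) :
  (forall k x, ulm p k x -> dvdg (p ^ k.+1) (f x)) -> jacobson f.
Proof.
move=> fulm M [[M0 MD MM] MT Mmax]; apply: contrapT => nMf.
have [||IM|IT] := Mmax [set h | exists m s, M m /\ h = m + s * f].
- split=> [|_ _ [m [s [Mm ->]]] [m' [s' [Mm' ->]]]|a _ [m [s [Mm ->]]]].
  + by exists 0, 0; rewrite mul0r addr0.
  + exists (m + m'), (s + s'); rewrite mulrDl addrACA; split=> //; exact: MD.
  + by exists (a * m), (a * s); rewrite mulrDr mulrA; split=> //; exact: MM.
- by move=> m Mm; exists m, 0; rewrite mul0r addr0.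
- by apply: nMf; rewrite -IM; exists 0, 1; rewrite mul1r add0r.
have : [set: endo H] 1 by []; rewrite -IT => -[m [s [Mm m1]]].
have /nilpotent_eltP[t st] : nilpotent_elt (s * f).
  apply: nilpotent_on_ulm_primary => k; exists 1%N => x ux.
  by rewrite expr1; apply: (dvdg_endo s); exact: fulm.
apply: MT; apply/seteqP; split=> // g _; rewrite -[g]mulr1; apply: (MM).
suff <- : (\sum_(i < t) (s * f) ^+ i) * m = 1 by exact: MM.
have -> : m = 1 - s * f by rewrite m1 addrK.
have cS : GRing.comm (1 - s * f) (\sum_(i < t) (s * f) ^+ i).
  apply: commr_sum => i _; apply: commrX; apply: commr_sym.
  by apply: commrB; [exact: commr1 | exact: commr_refl].
by rewrite -cS -opprB mulNr -subrX1 st sub0r opprK.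
Qed.

Lemma jquot_class_eq0 (f : endo H) : jquot_class f = 0 <-> jacobson f.
Proof.
rewrite -jquot_class0 jquot_classP subr0.
by split=> [/asboolP|Jf]; last apply/asboolP.
Qed.

Lemma jquot_classX (f : endo H) n : jquot_class f ^+ n = jquot_class (f ^+ n).
Proof.
by elim: n => // n IH; rewrite !exprS IH jquot_classM.
Qed.

Lemma nil_index_ge (R : pzRingType) (r : R) d : nilpotent_elt r ->
  r ^+ d != 0 -> (d < nil_index r)%N.
Proof.
rewrite /nil_index => nil_r rd; case: pselect => // ex_r.
case: ex_minnP => n /andP[_ /eqP rn] _; rewrite ltnNge; apply: contraNN rd.
by move=> nd; rewrite -(subnK nd) exprD rn mulr0.
Qed.

Lemma nil_index_expr (R : pzRingType) (r : R) d : (1 <= d < nil_index r)%N ->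
  nilpotent_elt r /\ r ^+ d <> 0.
Proof.
rewrite /nil_index; case: pselect => [ex_r|_]; last by rewrite ltn0 andbF.
case: ex_minnP => n _ minn /andP[d_gt0 dn]; split=> // rd.
by move: dn; rewrite ltnNge minn // d_gt0 rd eqxx.
Qed.

(* Attained by the shift along the family. *)
Lemma nil_degree_ulm_free k d (X : 'I_d -> H) : ulm_free p k X -> (0 < d)%N ->
  ((d%:Z)%:E <= nil_degree (jquot (endo H)))%E.
Proof.
case: d X => // d X fX _; have Xp := ulm_free_torsion fX; have [uX X0] := fX.
(* Extended by zero beyond the family, so that [f] shifts [x] without a boundary case. *)
pose x i := if insub i is Some j then X j else 0.
have xE (j : 'I_d.+1) : x j = X j by rewrite /x valK.
pose A := \matrix_(i < d.+1) (if insub i.+1 is Some j then delta_mx 0 j else 0)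
  : 'M['F_p]_d.+1.
have [f [fA fT]] := endo_of_matrix pr_p A fX.
have fx i : f (x i) = x i.+1.
  rewrite {1}/x; case: insubP => [j _ <-|].
    rewrite fA rowK /x; case: insubP => [j' _ _|_]; last exact: comb0.
    exact: comb_delta.
  rewrite -leqNgt raddf0 /x => di; rewrite insubF //.
  by apply/negbTE; rewrite -leqNgt (leq_trans di).
have fnx n i : (f ^+ n) (x i) = x (n + i)%N.
  by elim: n => // n IH; rewrite exprS [LHS]/= IH fx.
have nil_f : nilpotent_elt (jquot_class f).
  (* One application of [f] sends [G[p]] into the span of the [d.+1] members of [X], and [d.+1] more
     kill that span. *)
  apply/nilpotent_eltP; exists d.+2; rewrite jquot_classX.
  apply/jquot_class_eq0; apply: ulm_jacobson => j z [_ zp].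
  rewrite exprSr [X in dvdg _ X]/=; have [c ->] := fT z zp.
  rewrite endo_comb /comb big1 => [|i _]; first exact: dvdg0.
  rewrite /= -xE fnx /x insubF ?mul0rn //.
  by apply/negbTE; rewrite -leqNgt leq_addr.
have fd : jquot_class f ^+ d != 0.
  apply/eqP; rewrite jquot_classX => /jquot_class_eq0 Jf.
  have := jacobson_ulm Jf (uX ord0); rewrite -xE fnx addn0.
  rewrite (xE ord_max) -(comb_delta p) => /X0/rowP/(_ ord_max).
  by rewrite !mxE !eqxx => /eqP; rewrite oner_eq0.
apply: (@Order.POrderTheory.le_trans _ _ ((nil_index (jquot_class f))%:Z%:E)).
  by rewrite lee_fin lez_nat; exact: nil_index_ge.
by apply: (nil_degree_supremum (jquot (endo H))).1; exists (jquot_class f).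
Qed.

(** The family is the orbit of an [x] in some Ulm factor that [f ^+ d.-1] does not annihilate. *)
Lemma ulm_free_nil_degree d : (exists x : H, x <> 0) -> (0 < d)%N ->
  ((d%:Z)%:E <= nil_degree (jquot (endo H)))%E ->
  exists k (X : 'I_d -> H), ulm_free p k X.
Proof.
move=> [x0 x0N] d_gt0 dH.
have [f [t [ft fd]]] : exists (f : endo H) t,
    jacobson (f ^+ t) /\ ~ jacobson (f ^+ d.-1).
  (* For [d = 1], [f = 0] works: [f ^+ 0 = 1] is outside the radical because [H] is nonzero. *)
  have [d1|d_gt1] := leqP d 1.
    exists 0, 1%N; rewrite expr1 (_ : d.-1 = 0%N) ?expr0; last by lia.
    split=> [|J1]; first by apply/jquot_class_eq0; exact: jquot_class0.
    have /nilpotent_eltP[t] : nilpotent_elt (1 : endo H).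
      apply: nilpotent_on_ulm_primary => k; exists 1%N => x.
      by rewrite expr1; exact: jacobson_ulm.
    by rewrite expr1n => /(congr1 (fun g : endo H => g x0)).
  have [r dr] : exists r : jquot (endo H), (d <= nil_index r)%N.
    apply: contrapT => nr.
    suff : (d%:Z%:E <= d.-1%:Z%:E)%E by rewrite lee_fin lez_nat; lia.
    apply: (Order.POrderTheory.le_trans dH).
    apply: (nil_degree_supremum (jquot (endo H))).2 => _ [r _ <-].
    rewrite lee_fin lez_nat -ltnS prednK // ltnNge; apply/negP => dr.
    by apply: nr; exists r.
  have [/nilpotent_eltP[t rt] rd] : nilpotent_elt r /\ r ^+ d.-1 <> 0.
    by apply: nil_index_expr; lia.
  exists (jquot_repr r), t; rewrite -!jquot_class_eq0 -!jquot_classX.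
  by rewrite !jquot_reprK.
have [k [x [ux nfdx]]] : exists k x,
    ulm p k x /\ ~ dvdg (p ^ k.+1) ((f ^+ d.-1) x).
  apply: contrapT => nex; apply: fd; apply: ulm_jacobson => k x ux.
  by apply: contrapT => ndvd; apply: nex; exists k, x.
exists k, (fun i : 'I_d => (f ^+ i) x).
have ufx i : ulm p k ((f ^+ i) x).
  by split; [exact/dvdg_endo/ux.1 | rewrite -raddfMn ux.2 raddf0].
split=> // c dvd_c.
have dvdf i j : (i <= j)%N -> dvdg (p ^ k.+1) ((f ^+ i) x) ->
    dvdg (p ^ k.+1) ((f ^+ j) x).
  by move=> ij; rewrite -(subnK ij) exprD; exact: dvdg_endo.
(* Let [e] be the last exponent for which [(f ^+ e) x] is nonzero in the Ulm factor; it exists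
   because [f ^+ t] is in the radical. *)
have ex_e : exists e, `[< ~ dvdg (p ^ k.+1) ((f ^+ e) x) >].
  by exists d.-1; apply/asboolP.
have ub_e e : `[< ~ dvdg (p ^ k.+1) ((f ^+ e) x) >] -> (e <= t)%N.
  move=> /asboolP nfe; rewrite leqNgt; apply/negP => /ltnW te; apply: nfe.
  by apply: dvdf te _; exact: jacobson_ulm.
case: (ex_maxnP ex_e ub_e) => e /asboolP nfe maxe.
have le_de : (d.-1 <= e)%N by apply: maxe; apply/asboolP.
have dvd_gt j : (e < j)%N -> dvdg (p ^ k.+1) ((f ^+ j) x).
  move=> ej; apply: contrapT => nfj.
  by have := maxe j (asboolT nfj); rewrite leqNgt ej.
suff c0 n (i : 'I_d) : (i < n)%N -> c 0 i = 0.
  by apply/rowP => i; rewrite mxE; exact: c0 (ltn_ord i).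
elim: n i => // n IH i.
rewrite ltnS leq_eqVlt => /orP[/eqP i_n|]; last exact: IH.
apply/eqP; apply: contrapT => /negP ci; apply: nfe.
have ie : (i <= e)%N by have := ltn_ord i; lia.
(* Apply [f ^+ (e - i)] to the relation: coefficients before [i] vanish by induction, and later
   terms carry exponents beyond [e]. *)
have dvd_fc : dvdg (p ^ k.+1) ((f ^+ e) x *+ c 0 i).
  have := dvdg_endo (f ^+ (e - i)) dvd_c.
  rewrite endo_comb /comb (bigD1 i) //= => /dvdgB.
  set S := \sum_(_ < _ | _) _; move=> /(_ S).
  have fE j : (f ^+ (e - i)) ((f ^+ j) x) = (f ^+ (e - i + j)) x.
    by rewrite exprD.
  rewrite addrK fE subnK //; apply.
  apply: big_ind => [|y z|j ji]; [exact: dvdg0 | exact: dvdgD |].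
  have [jn|nj] := ltnP j n; first by rewrite IH // mulr0n; exact: dvdg0.
  apply: dvdgMn; rewrite fE; apply: dvd_gt.
  have : (j != i :> nat)%N by [].
  by lia.
have fep : (f ^+ e) x *+ p = 0 by have [] := ufx e.
rewrite -[(f ^+ e) x]mulr1n.
have := dvdgMn ((c 0 i)^-1 : 'F_p) dvd_fc.
by rewrite -mulrFpM // mulfV //= modn_small.
Qed.

End JacobsonRadical.

(** * Passage between a group and its primary components *)

Section PrimaryComponent.
Variables (p : nat) (pr_p : prime p) (G : zmodType).

Lemma primary_valMn (x : primary p G) n :
  primary_val (x *+ n) = primary_val x *+ n.
Proof. exact: (raddfMn (val : primary p G -> G)). Qed.

(** If [X i = y *+ p ^ k] is killed by [p], then [y] is killed by [p ^ k.+1], so divisibility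
    already holds inside the component. *)
Lemma ulm_free_primary k d (X : 'I_d -> G) : ulm_free p k X ->
  exists Y : 'I_d -> primary p G, ulm_free p k Y.
Proof.
move=> [uX X0].
have /choice[Y YP] (i : 'I_d) :
    exists y : primary p G, primary_val y *+ p ^ k = X i.
  have [[y Xy] Xp] := uX i.
  have yp : y \in @primary_pred p G.
    by apply/asboolP; exists k.+1; rewrite expnSr mulrnA -Xy.
  by exists (Primary yp).
exists (fun i => Y i *+ p ^ k); split=> [i|c [h]].
  split; first exact: dvdg_mulrn.
  by apply: val_inj; rewrite /= !primary_valMn YP (uX i).2.
move=> /(congr1 (val : primary p G -> G)) E; apply: X0; exists (val h).
move: E; rewrite raddf_sum /= primary_valMn => <-.
by apply: eq_bigr => i _; rewrite !primary_valMn YP.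
Qed.

Lemma primary_ulm_free k d (X : 'I_d -> primary p G) : ulm_free p k X ->
  ulm_free p k (fun i => primary_val (X i)).
Proof.
move=> fX; have Xp := ulm_free_torsion fX; have [uX X0] := fX.
split=> [i|c [h E]].
  have [[y Xy] _] := uX i; split; last by rewrite -primary_valMn Xp.
  by exists (primary_val y); rewrite -primary_valMn -Xy.
have combE : primary_val (comb X c) = comb (fun i => primary_val (X i)) c.
  rewrite [LHS](raddf_sum (val : primary p G -> G)); apply: eq_bigr => i _.
  exact: primary_valMn.
have hp : h \in @primary_pred p G.
  apply/asboolP; exists k.+2; rewrite expnSr mulrnA -E -combE -primary_valMn.
  by rewrite comb_torsion.
apply: X0; exists (Primary hp); apply: val_inj.
by rewrite /= primary_valMn combE.
Qed.

(** An element killed by [n] and by [p ^ k] is killed by their gcd, a divisor of [p ^ logn p n]. *)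
Lemma primary_bounded_exponent n : (0 < n)%N -> bounded_exponent n G ->
  bounded_exponent (p ^ logn p n) (primary p G).
Proof.
move=> n_gt0 nG [x xp]; apply: val_inj; rewrite /= primary_valMn /=.
have /asboolP[k xk] := xp.
have [n' pn' Dn] := pfactor_coprime pr_p n_gt0.
suff : (gcdn n (p ^ k) %| p ^ logn p n)%N.
  by move=> /dvdnP[c ->]; rewrite mulnC mulrnA mulrn_gcdn ?mul0rn.
by rewrite gcdnC {1}Dn Gauss_gcdr ?coprimeXl // dvdn_gcdr.
Qed.

End PrimaryComponent.

(** For a nonzero component and [1 <= i], free families of length [i] exist exactly when [i] is at
    most the degree of nilpotency. *)
Lemma ulm_bound_nil_degreeP (m n : nat) (G : zmodType) : (0 < n)%N ->
  bounded_exponent n G ->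
  ulm_bound m G <->
  forall p : nat, prime p -> (exists x : primary p G, x <> 0) ->
    forall i : nat, (1 <= i)%N ->
      ((i%:Z)%:E <= nil_degree (jquot (endo (primary p G))))%E ->
      (p ^ i - 1 %| m - 1)%N.
Proof.
move=> n_gt0 nG; split=> [Dm p pr_p nz i i_gt0 iJ|Dm p k d X pr_p fX i].
  have pG := primary_bounded_exponent pr_p n_gt0 nG.
  have [k [X fX]] := ulm_free_nil_degree pr_p pG nz i_gt0 iJ.
  apply: (Dm _ _ _ _ pr_p (primary_ulm_free fX)).
  by rewrite i_gt0 leqnn.
move=> /andP[i_gt0 id].
have [Y fY] := ulm_free_sub pr_p fX id.
have [Z fZ] := ulm_free_primary fY.
have pG := primary_bounded_exponent pr_p n_gt0 nG.
apply: Dm => //; last exact: (nil_degree_ulm_free pr_p pG fZ i_gt0).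
(* A member of a free family is nonzero, so the component is nonzero. *)
exists (Z (Ordinal i_gt0)) => Z0.
have /(proj2 fZ)/rowP/(_ (Ordinal i_gt0)) :
    dvdg (p ^ k.+1) (comb (p := p) Z (delta_mx 0 (Ordinal i_gt0))).
  by rewrite comb_delta Z0; exact: dvdg0.
by rewrite !mxE !eqxx => /eqP; rewrite oner_eq0.
Qed.

Theorem theorem3p6 (m : nat) (m_gt1 : (1 < m)%N) (G : zmodType) :
  strongly_nil_clean (endo G) m <->
  (finite_set [set: G]%classic /\
   forall p : nat, prime p -> (exists x : primary p G, x <> 0%R) ->
     forall i : nat, (1 <= i)%N ->
       ((i%:Z)%:E <= nil_degree (jquot (endo (primary p G))))%E ->
       (p ^ i - 1 %| m - 1)%N).
Proof.
split=> [snc|[finG]].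
  have nil_f (f : endo G) : nilpotent_elt (f ^+ m - f).
    exact: strongly_nil_clean_nilpotent.
  have [n n_gt0 nG] := potent_bounded_exponent m_gt1 nil_f.
  have Dm : ulm_bound m G.
    by move=> p k d X pr_p fX i; exact: (ulm_free_potent pr_p fX m_gt1 nil_f).
  split; first exact: (finite_of_ulm_bound n_gt0 nG m_gt1 Dm).
  exact/(ulm_bound_nil_degreeP _ n_gt0 nG).
have [n n_gt0 nG] := finite_bounded_exponent finG.
move=> /(ulm_bound_nil_degreeP _ n_gt0 nG) Dm.
apply: (strongly_nil_cleanP n_gt0 m_gt1) => [|f].
  by apply: endoP => x; rewrite natr_endoE nG.
exact: (potent_of_ulm_bound n_gt0 nG f m_gt1 Dm).
Qed.
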